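(* Let $x\in\mathbb{C}$ with $\mathrm{Re}(x)>0$. With infinite products understood as zeta-regularized products, $$\bar\Gamma_1(x)=\prod_{n=0}^\infty(n+x)^{(-1)^{n+1}}=\frac{1}{\sqrt2}\,\frac{\Gamma\left(\frac x2\right)}{\Gamma\left(\frac{x+1}{2}\right)}.$$ Equivalently, $$\prod_{n=0}^\infty(n+x)^{(-1)^n}=\frac{\sqrt{\pi/2}}{\tilde\Gamma(x)}.$$ In particular, $\bar\Gamma_1(1)=\prod_{n=1}^\infty n^{(-1)^n}=\sqrt{\pi/2}$.
   Context: $\Gamma$ is the Euler gamma function. For $\mathrm{Re}(x)>0$, $\zeta_E(s,x)=\sum_{m=0}^\infty(-1)^m(m+x)^{-s}$ for $\mathrm{Re}(s)>0$ (principal branch), continued analytically to an entire function of $s$, and $\bar\Gamma_1(x)=\exp\left(\frac{\partial}{\partial s}\zeta_E(s,x)\big|_{s=0}\right)$. Zeta-regularized products: for $\epsilon_n\in\{\pm1\}$, $\prod_na_n^{\epsilon_n}:=\exp(-F'(0))$, where $F$ is the analytic continuation to $s=0$ of $F(s)=\sum_n\epsilon_na_n^{-s}$. The modified gamma function is $$\tilde\Gamma(x)=\frac1x e^{x\log 2}\prod_{m=1}^\infty\left(e^{-x/m}\left(1+\frac xm\right)\right)^{(-1)^{m+1}},$$ with this last infinite product an ordinary convergent product (equivalently, $\frac{d}{dx}\log\tilde\Gamma(x)=-\zeta_E(1,x)$ and $\tilde\Gamma(1)=\pi/2$). *)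

(* Defs.v *)
From Stdlib Require Import Reals ClassicalEpsilon.
From Coquelicot Require Import Coquelicot.
Open Scope R_scope.

Definition Cexp (z : C) : C :=
  (exp (Re z) * cos (Im z), exp (Re z) * sin (Im z)).

(* Principal argument, in (-PI, PI]; only meaningful for [z <> 0]. *)
Definition Carg (z : C) : R :=
  if Rle_dec 0 (Im z) then acos (Re z / Cmod z) else - acos (Re z / Cmod z).

Definition Clog (z : C) : C := (ln (Cmod z), Carg z).

Definition Cpower (a s : C) : C := Cexp (s * Clog a)%C.

(* Complex differentiability: the scalars are C, not R. *)
Definition C_ex_derive (f : C -> C) (z : C) : Prop :=
  @ex_derive C_AbsRing C_NormedModule f z.

Definition C_is_series (a : nat -> C) (l : C) : Prop :=
  @is_series C_AbsRing C_NormedModule a l.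

(* Euler's integral; used only at points of positive real part, where it
   converges. *)
Definition Gamma (z : C) : C :=
  @RInt_gen C_R_CompleteNormedModule
    (fun t : R => (Cpower (RtoC t) (z - RtoC 1) * RtoC (exp (- t)))%C)
    (at_right 0) (Rbar_locally p_infty).

Definition zetaE_term (x s : C) (m : nat) : C :=
  (RtoC ((-1) ^ m) * Cpower (RtoC (INR m) + x) (- s))%C.

Definition is_zetaE (x : C) (Z : C -> C) : Prop :=
  (forall s : C, C_ex_derive Z s) /\
  (forall s : C, 0 < Re s -> C_is_series (zetaE_term x s) (Z s)).

(* The entire function of [s] continuing the series: at most one function
   satisfies [is_zetaE x], by the identity theorem. *)
Definition zetaE (s x : C) : C :=
  epsilon (inhabits (fun _ : C => RtoC 0)) (is_zetaE x) s.

Definition barGamma1 (x : C) : C :=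
  Cexp (C_derive (fun s : C => zetaE s x) (RtoC 0)).

Definition path_connected (U : C -> Prop) : Prop :=
  forall z w : C, U z -> U w ->
  exists g : R -> C,
    (forall t : R, continuous g t) /\ g 0 = z /\ g 1 = w /\
    (forall t : R, 0 <= t <= 1 -> U (g t)).

Definition zreg_term (a : nat -> C) (eps : nat -> R) (s : C) (n : nat) : C :=
  (RtoC (eps n) * Cpower (a n) (- s))%C.

Definition zreg_converges (a : nat -> C) (eps : nat -> R) (sigma : R) : Prop :=
  forall s : C, sigma < Re s -> exists l : C, C_is_series (zreg_term a eps s) l.

(* [F] is holomorphic on a domain [U] containing 0 and the whole open
   half-plane of convergence of the series, and is its sum there. *)
Definition is_zreg_continuation
    (a : nat -> C) (eps : nat -> R) (F : C -> C) : Prop :=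
  (exists sigma : R, zreg_converges a eps sigma) /\
  exists U : C -> Prop,
    open U /\ path_connected U /\ U (RtoC 0) /\
    (forall s : C, U s -> C_ex_derive F s) /\
    (forall sigma : R, zreg_converges a eps sigma ->
     forall s : C, sigma < Re s ->
     U s /\ C_is_series (zreg_term a eps s) (F s)).

(* "The zeta-regularized product of the [a n ^ eps n] is [P]": a continuation
   to 0 exists, and the value does not depend on which one is taken. *)
Definition is_zreg_prod (a : nat -> C) (eps : nat -> R) (P : C) : Prop :=
  (forall n : nat, a n <> RtoC 0 /\ (eps n = 1 \/ eps n = -1)) /\
  (exists F : C -> C, is_zreg_continuation a eps F) /\
  (forall F : C -> C, is_zreg_continuation a eps F ->
   P = Cexp (- C_derive F (RtoC 0))%C).

Fixpoint Cprod (u : nat -> C) (n : nat) : C :=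
  match n with
  | O => RtoC 1
  | S k => (Cprod u k * u k)%C
  end.

Definition Cprod_infty (u : nat -> C) : C :=
  @iota C_R_CompleteNormedModule
    (fun l => filterlim (Cprod u) eventually (locally l)).

(* The exponent (-1)^(m+1) is 1 for odd [m] and -1 for even [m]. *)
Definition tGamma_factor (x : C) (m : nat) : C :=
  let f := (Cexp (- (x / RtoC (INR m))) * (RtoC 1 + x / RtoC (INR m)))%C in
  if Nat.odd m then f else (/ f)%C.

(* Products are indexed from 0, hence the shift to start at m = 1. *)
Definition tGamma (x : C) : C :=
  (/ x * Cexp (x * RtoC (ln 2)) *
   Cprod_infty (fun k : nat => tGamma_factor x (S k)))%C.

(* Main.v *)
Require Import Defs.
From Stdlib Require Import Reals Factorial Lra Lia ClassicalEpsilon FunctionalExtensionality.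
From Coquelicot Require Import Coquelicot.
Open Scope R_scope.

(** Write [Z s] for the sum of the [(-1)^m (m + x)^(-s)]. Replacing the terms
    [g m] of an alternating series by half of [g m - g (m + 1)], as Euler did,
    keeps its sum up to the explicit term [g 0 / 2] and gains one power of [m],
    because a difference is controlled by a derivative. After [n] such steps
    the series for [Z] converges absolutely, locally uniformly on a half-plane
    that grows with [n], and different [n] give the same value
    ([Euler_sum_unique]). So Euler summation defines [Z] everywhere; a second
    order Taylor estimate, summed termwise, shows that it is entire and that
    [Z' 0] is the Euler sum of the [- Clog (m + x)] ([is_derive_eta_log],
    [is_zetaE_eta_log]).

    Any other admissible continuation equals the series on [Re s > 0]. Since 0
    lies on the boundary of that half-plane, its derivative at 0 can be computed
    along the positive reals and must be [Z' 0] ([derive_0_half_plane],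
    [is_zreg_prod_intro]).

    Exponentiating the Euler sum of logarithms gives an ordinary limit,
    [barGamma1 x = lim (2M)^(-1/2) prod_(j<M) (2j+1+x)/(2j+x)]
    ([barGamma1_limit]), and each closed form compares this limit with a
    classical product.
    - The same finite products, up to [sqrt n], are the quotients of Gauss's
      products for [Gamma] at [x/2] and [(x+1)/2] ([gauss_product_ratio]), and
      Gauss's products converge to Euler's integral ([Gamma_gauss]).
    - At [x = 1] they are Wallis's products, with limit [sqrt (PI / 2)]
      ([barGamma1_1]).
    - The even partial products of [tGamma x] are the finite products for [x]
      times those for 1, up to an exponential whose exponent is a partial sum of
      the series for [- x ln 2] and a rational factor; hence
      [tGamma x = sqrt (PI / 2) * barGamma1 x] ([tGamma_barGamma1]). *)

(** * Moduli and components *)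

Ltac c_simpl :=
  unfold Re, Im, Cdiv, Cminus, Cplus, Copp, Cmult, Cinv, Ci, RtoC in *; simpl in *.

Lemma C_ext (z w : C) : Re z = Re w -> Im z = Im w -> z = w.
Proof. destruct z, w; simpl; congruence. Qed.

Lemma Im_le_Cmod (z : C) : Rabs (Im z) <= Cmod z.
Proof.
  apply Rle_trans with (2 := Rmax_Cmod z). apply Rmax_r.
Qed.

Lemma Cmod_le_abs (z : C) : Cmod z <= Rabs (Re z) + Rabs (Im z).
Proof.
  replace z with (RtoC (Re z) + Ci * RtoC (Im z))%C at 1
    by (apply C_ext; c_simpl; ring).
  eapply Rle_trans; [apply Cmod_triangle|].
  rewrite Cmod_mult, Cmod_Ci, !Cmod_R; lra.
Qed.

Lemma Cmod_sub_sym (z w : C) : Cmod (z - w) = Cmod (w - z).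
Proof. rewrite <- Cmod_opp; f_equal; ring. Qed.

Lemma Cmod_sub_le (z w : C) : Cmod z - Cmod w <= Cmod (z - w).
Proof.
  assert (H := Cmod_triangle (z - w) w).
  replace (z - w + w)%C with z in H by ring. lra.
Qed.

Lemma Cmod_minus_le (z w : C) : Cmod (z - w) <= Cmod z + Cmod w.
Proof.
  unfold Cminus; eapply Rle_trans; [apply Cmod_triangle|]. rewrite Cmod_opp; lra.
Qed.

Lemma Cmod_Re_pos (z : C) : 0 <= Re z -> Re z <= Cmod z.
Proof. intros H. generalize (re_le_Cmod z). rewrite Rabs_pos_eq; lra. Qed.

Lemma Re_pos_neq_0 (z : C) : 0 < Re z -> z <> RtoC 0.
Proof. intros H ->; c_simpl; lra. Qed.

(** * Limits of complex sequences *)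

Definition C_lim_seq (u : nat -> C) (l : C) : Prop :=
  is_lim_seq (fun n => Cmod (u n - l)) 0.

Lemma is_lim_seq_squeeze_0 (u v : nat -> R) :
  (forall n, 0 <= u n <= v n) -> is_lim_seq v 0 -> is_lim_seq u 0.
Proof.
  intros H Hv. apply is_lim_seq_le_le with (u := fun _ => 0) (w := v); auto.
  apply is_lim_seq_const.
Qed.

Lemma C_lim_seq_dominated (u : nat -> C) (l : C) (v : nat -> R) :
  (forall n, Cmod (u n - l) <= v n) -> is_lim_seq v 0 -> C_lim_seq u l.
Proof.
  intros H Hv. apply is_lim_seq_squeeze_0 with (2 := Hv).
  intros n; split; [apply Cmod_ge_0 | apply H].
Qed.

Lemma C_lim_seq_components (u : nat -> C) (l : C) :
  C_lim_seq u l <->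
  is_lim_seq (fun n => Re (u n)) (Re l) /\ is_lim_seq (fun n => Im (u n)) (Im l).
Proof.
  split.
  - intros H; split.
    + apply is_lim_seq_ext with (fun n => Re l + Re (u n - l)).
      { intros n; c_simpl; ring. }
      replace (Finite (Re l)) with (Finite (Re l + 0)) by (f_equal; ring).
      apply is_lim_seq_plus'; [apply is_lim_seq_const|].
      apply is_lim_seq_abs_0. apply is_lim_seq_squeeze_0 with (2 := H).
      intros n; split; [apply Rabs_pos | apply re_le_Cmod].
    + apply is_lim_seq_ext with (fun n => Im l + Im (u n - l)).
      { intros n; c_simpl; ring. }
      replace (Finite (Im l)) with (Finite (Im l + 0)) by (f_equal; ring).
      apply is_lim_seq_plus'; [apply is_lim_seq_const|].
      apply is_lim_seq_abs_0. apply is_lim_seq_squeeze_0 with (2 := H).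
      intros n; split; [apply Rabs_pos | apply Im_le_Cmod].
  - intros [H1 H2].
    apply C_lim_seq_dominated with
      (fun n => Rabs (Re (u n) - Re l) + Rabs (Im (u n) - Im l)).
    { intros n; apply (Cmod_le_abs (u n - l)). }
    replace 0 with (Rabs (Re l - Re l) + Rabs (Im l - Im l))
      by (rewrite !Rminus_diag, !Rabs_R0; ring).
    apply is_lim_seq_plus'.
    + apply (is_lim_seq_abs _ (Finite (Re l - Re l))).
      apply is_lim_seq_minus'; [exact H1 | apply is_lim_seq_const].
    + apply (is_lim_seq_abs _ (Finite (Im l - Im l))).
      apply is_lim_seq_minus'; [exact H2 | apply is_lim_seq_const].
Qed.

Lemma C_lim_seq_unique (u : nat -> C) (l m : C) :
  C_lim_seq u l -> C_lim_seq u m -> l = m.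
Proof.
  rewrite !C_lim_seq_components. intros [H1 H2] [H3 H4].
  apply is_lim_seq_unique in H1, H2, H3, H4.
  apply C_ext; [rewrite H1 in H3 | rewrite H2 in H4]; congruence.
Qed.

Lemma C_lim_seq_ext_loc (u v : nat -> C) (l : C) :
  (exists N, forall n, (N <= n)%nat -> u n = v n) -> C_lim_seq u l -> C_lim_seq v l.
Proof.
  intros [N H]. apply is_lim_seq_ext_loc. exists N. intros n Hn. now rewrite H.
Qed.

Lemma C_lim_seq_ext (u v : nat -> C) (l : C) :
  (forall n, u n = v n) -> C_lim_seq u l -> C_lim_seq v l.
Proof. intros H; apply C_lim_seq_ext_loc; exists O; auto. Qed.

Lemma C_lim_seq_const (l : C) : C_lim_seq (fun _ => l) l.
Proof. apply C_lim_seq_components; split; apply is_lim_seq_const. Qed.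

Lemma C_lim_seq_plus (u v : nat -> C) (l m : C) :
  C_lim_seq u l -> C_lim_seq v m -> C_lim_seq (fun n => u n + v n)%C (l + m)%C.
Proof.
  rewrite !C_lim_seq_components. intros [H1 H2] [H3 H4].
  split; c_simpl; apply is_lim_seq_plus'; auto.
Qed.

Lemma C_lim_seq_mult (u v : nat -> C) (l m : C) :
  C_lim_seq u l -> C_lim_seq v m -> C_lim_seq (fun n => u n * v n)%C (l * m)%C.
Proof.
  rewrite !C_lim_seq_components. intros [H1 H2] [H3 H4].
  split; c_simpl;
    [apply is_lim_seq_minus' | apply is_lim_seq_plus']; apply is_lim_seq_mult'; auto.
Qed.

Lemma C_lim_seq_scal (c : C) (u : nat -> C) (l : C) :
  C_lim_seq u l -> C_lim_seq (fun n => c * u n)%C (c * l)%C.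
Proof. intros H. apply (C_lim_seq_mult (fun _ => c)); auto using C_lim_seq_const. Qed.

Lemma C_lim_seq_minus (u v : nat -> C) (l m : C) :
  C_lim_seq u l -> C_lim_seq v m -> C_lim_seq (fun n => u n - v n)%C (l - m)%C.
Proof.
  intros H1 H2. apply C_lim_seq_plus; auto.
  apply C_lim_seq_ext with (fun n => (-1) * v n)%C; [intros; ring|].
  replace (- m)%C with ((-1) * m)%C by ring. now apply C_lim_seq_scal.
Qed.

Lemma C_lim_seq_RtoC (u : nat -> R) (l : R) :
  is_lim_seq u l -> C_lim_seq (fun n => RtoC (u n)) (RtoC l).
Proof. intros H; apply C_lim_seq_components; split; c_simpl; auto using is_lim_seq_const. Qed.

Lemma C_lim_seq_Cmod (u : nat -> C) (l : C) :
  C_lim_seq u l -> is_lim_seq (fun n => Cmod (u n)) (Cmod l).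
Proof.
  intros H. apply is_lim_seq_ext with (fun n => Cmod l + (Cmod (u n) - Cmod l)).
  { intros; ring. }
  replace (Finite (Cmod l)) with (Finite (Cmod l + 0)) by (f_equal; ring).
  apply is_lim_seq_plus'; [apply is_lim_seq_const|].
  apply is_lim_seq_abs_0. apply is_lim_seq_squeeze_0 with (2 := H).
  intros n; split; [apply Rabs_pos|].
  apply Rabs_le. generalize (Cmod_sub_le (u n) l) (Cmod_sub_le l (u n)).
  rewrite (Cmod_sub_sym l). lra.
Qed.

Lemma C_lim_seq_Cmod_le (u : nat -> C) (l : C) (B : R) :
  C_lim_seq u l -> (forall n, Cmod (u n) <= B) -> Cmod l <= B.
Proof.
  intros H HB.
  apply (is_lim_seq_le (fun n => Cmod (u n)) (fun _ => B) (Cmod l) B HB).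
  - now apply C_lim_seq_Cmod.
  - apply is_lim_seq_const.
Qed.

Lemma C_lim_seq_inv (u : nat -> C) (l : C) :
  l <> RtoC 0 -> C_lim_seq u l -> C_lim_seq (fun n => / u n)%C (/ l)%C.
Proof.
  intros Hl H. assert (H' := H). apply C_lim_seq_components in H as [H1 H2].
  assert (Hn : Re l ^ 2 + Im l ^ 2 <> 0).
  { intros E. apply Hl. apply C_ext; c_simpl; nra. }
  assert (Hq : is_lim_seq (fun n => / (Re (u n) ^ 2 + Im (u n) ^ 2))
                          (/ (Re l ^ 2 + Im l ^ 2))).
  { apply (is_lim_seq_inv _ (Finite (Re l ^ 2 + Im l ^ 2))); [|congruence].
    apply is_lim_seq_plus'; simpl; repeat apply is_lim_seq_mult';
      auto using is_lim_seq_const. }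
  apply C_lim_seq_components; split; c_simpl; unfold Rdiv; apply is_lim_seq_mult'; auto.
  apply (is_lim_seq_opp _ (Finite (Im l))); auto.
Qed.

Lemma C_lim_seq_div (u v : nat -> C) (l m : C) :
  m <> RtoC 0 ->
  C_lim_seq u l -> C_lim_seq v m -> C_lim_seq (fun n => u n / v n)%C (l / m)%C.
Proof. intros; apply C_lim_seq_mult; auto using C_lim_seq_inv. Qed.

Lemma C_lim_seq_subseq (u : nat -> C) (l : C) (phi : nat -> nat) :
  filterlim phi eventually eventually -> C_lim_seq u l -> C_lim_seq (fun n => u (phi n)) l.
Proof. intros H Hu. exact (is_lim_seq_subseq _ _ phi H Hu). Qed.

Lemma filterlim_C_lim_seq (u : nat -> C) (l : C) :
  C_lim_seq u l -> filterlim u eventually (@locally C_UniformSpace l).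
Proof.
  rewrite C_lim_seq_components. intros [H1 H2].
  intros P [eps HP].
  assert (K1 := H1 (ball (Re l) eps) (locally_ball (Re l) eps)).
  assert (K2 := H2 (ball (Im l) eps) (locally_ball (Im l) eps)).
  unfold filtermap in *. generalize (filter_and _ _ K1 K2).
  apply filter_imp. intros n [h1 h2]. apply HP. split; assumption.
Qed.

Lemma C_lim_seq_filterlim (u : nat -> C) (l : C) :
  filterlim u eventually (@locally C_UniformSpace l) -> C_lim_seq u l.
Proof.
  intros H. apply C_lim_seq_components. split.
  - intros P [eps HP]. apply (H (fun z => P (Re z))). exists eps.
    intros z [h1 _]. now apply HP.
  - intros P [eps HP]. apply (H (fun z => P (Im z))). exists eps.
    intros z [_ h2]. now apply HP.
Qed.

(** * Series *)

Fixpoint Csum (u : nat -> C) (n : nat) : C :=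
  match n with O => RtoC 0 | S k => (Csum u k + u k)%C end.

Lemma sum_n_Csum (u : nat -> C) (n : nat) :
  @sum_n C_AbelianGroup u n = Csum u (S n).
Proof.
  induction n as [|n IH].
  - rewrite sum_O. simpl. ring.
  - rewrite sum_Sn, IH. reflexivity.
Qed.

Lemma C_is_series_lim (u : nat -> C) (l : C) :
  C_is_series u l <-> C_lim_seq (Csum u) l.
Proof.
  split; intros H.
  - apply (is_lim_seq_incr_1 (fun n => Cmod (Csum u n - l))).
    apply (C_lim_seq_ext (@sum_n C_AbelianGroup u)); [apply sum_n_Csum|].
    apply C_lim_seq_filterlim. exact H.
  - apply filterlim_C_lim_seq.
    apply C_lim_seq_ext with (fun n => Csum u (S n)).
    { intros n; symmetry; apply sum_n_Csum. }
    apply (is_lim_seq_incr_1 (fun n => Cmod (Csum u n - l))). exact H.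
Qed.

(** * Differentiation of complex-valued functions of a real variable *)

Definition is_path_derive (f : R -> C) (t : R) (l : C) : Prop :=
  is_derive (fun u => Re (f u)) t (Re l) /\ is_derive (fun u => Im (f u)) t (Im l).

Lemma is_derive_eq (f : R -> R) (t l m : R) : is_derive f t l -> l = m -> is_derive f t m.
Proof. now intros H <-. Qed.

Lemma path_derive_eq (f : R -> C) (t : R) (l m : C) :
  is_path_derive f t l -> l = m -> is_path_derive f t m.
Proof. now intros H <-. Qed.

Lemma path_derive_ext (f g : R -> C) (t : R) (l : C) :
  (forall u, f u = g u) -> is_path_derive f t l -> is_path_derive g t l.
Proof.
  intros H [H1 H2]; split;
    [apply is_derive_ext with (2 := H1) | apply is_derive_ext with (2 := H2)];
    intros u; now rewrite H.
Qed.

Lemma path_derive_const (c : C) (t : R) : is_path_derive (fun _ => c) t (RtoC 0).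
Proof. split; apply (is_derive_const (K := R_AbsRing) (V := R_NormedModule)). Qed.

Lemma path_derive_RtoC (f : R -> R) (t l : R) :
  is_derive f t l -> is_path_derive (fun u => RtoC (f u)) t (RtoC l).
Proof.
  intros H; split; [exact H | exact (is_derive_const (K := R_AbsRing) (V := R_NormedModule) 0 t)].
Qed.

Lemma path_derive_plus (f g : R -> C) (t : R) (l m : C) :
  is_path_derive f t l -> is_path_derive g t m ->
  is_path_derive (fun u => f u + g u)%C t (l + m)%C.
Proof.
  intros [H1 H2] [H3 H4]; split; apply @is_derive_plus; assumption.
Qed.

Lemma path_derive_mult (f g : R -> C) (t : R) (l m : C) :
  is_path_derive f t l -> is_path_derive g t m ->
  is_path_derive (fun u => f u * g u)%C t (l * g t + f t * m)%C.
Proof.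
  intros [H1 H2] [H3 H4]; split.
  - eapply is_derive_eq.
    + apply (is_derive_minus (V := R_NormedModule)
        (fun u => Re (f u) * Re (g u)) (fun u => Im (f u) * Im (g u)));
        (apply (is_derive_mult (K := R_AbsRing));
         [eassumption | eassumption | intros; apply Rmult_comm]).
    + unfold minus, plus, opp, mult; c_simpl. ring.
  - eapply is_derive_eq.
    + apply (is_derive_plus (V := R_NormedModule)
        (fun u => Re (f u) * Im (g u)) (fun u => Im (f u) * Re (g u)));
        (apply (is_derive_mult (K := R_AbsRing));
         [eassumption | eassumption | intros; apply Rmult_comm]).
    + unfold minus, plus, opp, mult; c_simpl. ring.
Qed.

Lemma path_derive_scal (c : C) (f : R -> C) (t : R) (l : C) :
  is_path_derive f t l -> is_path_derive (fun u => c * f u)%C t (c * l)%C.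
Proof.
  intros H. eapply path_derive_eq.
  - apply (path_derive_mult (fun _ => c)); [apply path_derive_const | exact H].
  - ring.
Qed.

Lemma path_derive_minus (f g : R -> C) (t : R) (l m : C) :
  is_path_derive f t l -> is_path_derive g t m ->
  is_path_derive (fun u => f u - g u)%C t (l - m)%C.
Proof.
  intros [H1 H2] [H3 H4]; split; apply @is_derive_minus; assumption.
Qed.

Lemma path_derive_comp (f : R -> C) (g : R -> R) (t dg : R) (l : C) :
  is_path_derive f (g t) l -> is_derive g t dg ->
  is_path_derive (fun u => f (g u)) t (RtoC dg * l)%C.
Proof.
  intros [H1 H2] Hg; split; eapply is_derive_eq.
  - apply (is_derive_comp (K := R_AbsRing) (V := R_NormedModule) (fun u => Re (f u)) g);
      eassumption.
  - unfold scal; simpl; unfold mult; c_simpl; ring.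
  - apply (is_derive_comp (K := R_AbsRing) (V := R_NormedModule) (fun u => Im (f u)) g);
      eassumption.
  - unfold scal; simpl; unfold mult; c_simpl; ring.
Qed.

(** The mean value theorem for [g - f] and for [g + f]. *)
Lemma real_increment_le (f f' g g' : R -> R) (a b : R) :
  a <= b ->
  (forall t, a <= t <= b -> is_derive f t (f' t) /\ is_derive g t (g' t) /\ Rabs (f' t) <= g' t) ->
  Rabs (f b - f a) <= g b - g a.
Proof.
  intros Hab H.
  assert (K : forall e : R, Rabs e <= 1 ->  e * (f b - f a) <= g b - g a).
  { intros e He.
    destruct (MVT_gen (fun t => g t - e * f t) a b (fun t => g' t - e * f' t))
      as [c [Hc E]].
    - rewrite Rmin_left, Rmax_right by assumption. intros t Ht.
      destruct (H t) as [H1 [H2 _]]; [lra|].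
      apply (is_derive_minus (V := R_NormedModule)); auto.
      apply (is_derive_scal f t e (f' t)); auto.
    - rewrite Rmin_left, Rmax_right by assumption. intros t Ht.
      destruct (H t) as [H1 [H2 _]]; [lra|].
      apply derivable_continuous_pt. exists (g' t - e * f' t). apply is_derive_Reals.
      apply (is_derive_minus (V := R_NormedModule)); auto.
      apply (is_derive_scal f t e (f' t)); auto.
    - rewrite Rmin_left, Rmax_right in Hc by assumption.
      destruct (H c Hc) as [_ [_ H3]].
      assert (0 <= g' c - e * f' c).
      { assert (Rabs (e * f' c) <= 1 * g' c).
        { rewrite Rabs_mult. apply Rmult_le_compat; auto using Rabs_pos. }
        generalize (Rle_abs (e * f' c)). lra. }
      nra. }
  apply Rabs_le. split.
  - assert (X := K (-1)). rewrite Rabs_left in X by lra. lra.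
  - assert (X := K 1). rewrite Rabs_pos_eq in X by lra. lra.
Qed.

(** The factor 2 comes from treating the real and the imaginary part
    separately. *)
Lemma path_increment_le (F F' : R -> C) (G G' : R -> R) (a b : R) :
  a <= b ->
  (forall t, a <= t <= b -> is_path_derive F t (F' t)) ->
  (forall t, a <= t <= b -> is_derive G t (G' t)) ->
  (forall t, a <= t <= b -> Cmod (F' t) <= G' t) ->
  Cmod (F b - F a) <= 2 * (G b - G a).
Proof.
  intros Hab HF HG Hle.
  eapply Rle_trans; [apply Cmod_le_abs|].
  assert (H1 : Rabs (Re (F b) - Re (F a)) <= G b - G a).
  { apply (real_increment_le (fun t => Re (F t)) (fun t => Re (F' t)) G G' a b Hab). intros t Ht.
    split; [apply HF, Ht|split; [apply HG, Ht|]].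
    eapply Rle_trans; [apply re_le_Cmod | apply Hle, Ht]. }
  assert (H2 : Rabs (Im (F b) - Im (F a)) <= G b - G a).
  { apply (real_increment_le (fun t => Im (F t)) (fun t => Im (F' t)) G G' a b Hab). intros t Ht.
    split; [apply HF, Ht|split; [apply HG, Ht|]].
    eapply Rle_trans; [apply Im_le_Cmod | apply Hle, Ht]. }
  change (Re (F b - F a)) with (Re (F b) - Re (F a)).
  change (Im (F b - F a)) with (Im (F b) - Im (F a)). lra.
Qed.

Lemma path_mean_value (F F' : R -> C) (a b M : R) :
  a <= b ->
  (forall t, a <= t <= b -> is_path_derive F t (F' t)) ->
  (forall t, a <= t <= b -> Cmod (F' t) <= M) ->
  Cmod (F b - F a) <= 2 * M * (b - a).
Proof.
  intros Hab HF HM.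
  replace (2 * M * (b - a)) with (2 * (M * b - M * a)) by ring.
  apply path_increment_le with F' (fun _ => M); auto.
  intros t _. auto_derive; auto; ring.
Qed.

(** * Exponential and logarithm *)

Lemma Cexp_plus (z w : C) : Cexp (z + w) = (Cexp z * Cexp w)%C.
Proof.
  unfold Cexp; apply C_ext; c_simpl;
    rewrite exp_plus, ?cos_plus, ?sin_plus; ring.
Qed.

Lemma Cexp_0 : Cexp (RtoC 0) = RtoC 1.
Proof. unfold Cexp; apply C_ext; c_simpl; rewrite exp_0, ?cos_0, ?sin_0; ring. Qed.

Lemma Cexp_RtoC (r : R) : Cexp (RtoC r) = RtoC (exp r).
Proof. unfold Cexp; apply C_ext; c_simpl; rewrite ?cos_0, ?sin_0; ring. Qed.

Lemma Cmod_Cexp (z : C) : Cmod (Cexp z) = exp (Re z).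
Proof.
  unfold Cexp, Cmod; c_simpl.
  replace (_ + _) with ((exp (fst z)) ^ 2 * ((sin (snd z))² + (cos (snd z))²))
    by (unfold Rsqr; ring).
  rewrite sin2_cos2, Rmult_1_r.
  apply sqrt_pow2. left; apply exp_pos.
Qed.

Lemma Cexp_neq_0 (z : C) : Cexp z <> RtoC 0.
Proof. apply Cmod_gt_0. rewrite Cmod_Cexp. apply exp_pos. Qed.

Lemma Cexp_opp (z : C) : Cexp (- z) = (/ Cexp z)%C.
Proof.
  assert (H : (Cexp z * Cexp (- z))%C = RtoC 1).
  { rewrite <- Cexp_plus, <- Cexp_0. f_equal; ring. }
  replace (Cexp (- z)) with (/ Cexp z * (Cexp z * Cexp (- z)))%C.
  - rewrite H; ring.
  - field. apply Cexp_neq_0.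
Qed.

Lemma Cexp_minus (z w : C) : Cexp (z - w) = (Cexp z / Cexp w)%C.
Proof. unfold Cminus. now rewrite Cexp_plus, Cexp_opp. Qed.

Lemma C_lim_seq_Cexp (u : nat -> C) (l : C) :
  C_lim_seq u l -> C_lim_seq (fun n => Cexp (u n)) (Cexp l).
Proof.
  rewrite !C_lim_seq_components. intros [H1 H2].
  assert (K : forall (f : R -> R) (v : nat -> R) (m : R), continuity f ->
    is_lim_seq v m -> is_lim_seq (fun n => f (v n)) (f m)).
  { intros f v m Hf Hv. apply is_lim_seq_continuous; auto. }
  assert (Ke := K exp _ _ (derivable_continuous _ derivable_exp) H1).
  split; unfold Cexp; cbv [Re Im fst snd]; apply is_lim_seq_mult'; auto.
  - apply (K cos); [apply continuity_cos | exact H2].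
  - apply (K sin); [apply continuity_sin | exact H2].
Qed.

Lemma path_derive_Cexp (f : R -> C) (t : R) (l : C) :
  is_path_derive f t l -> is_path_derive (fun u => Cexp (f u)) t (l * Cexp (f t))%C.
Proof.
  assert (K : forall a b : R -> R, forall la lb, is_derive a t la -> is_derive b t lb ->
    is_derive (fun u => exp (a u) * cos (b u)) t
      (exp (a t) * (la * cos (b t) - lb * sin (b t))) /\
    is_derive (fun u => exp (a u) * sin (b u)) t
      (exp (a t) * (la * sin (b t) + lb * cos (b t)))).
  { intros a b la lb H1 H2.
    split; auto_derive; try (repeat split; auto; eexists; eassumption);
      apply is_derive_unique in H1, H2;
      change (Derive (fun x => a x) t) with (Derive a t);
      change (Derive (fun x => b x) t) with (Derive b t);
      rewrite H1, H2; ring. }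
  intros [H1 H2]. destruct (K _ _ _ _ H1 H2) as [K1 K2].
  split; (eapply is_derive_eq; [eassumption | unfold Cexp; c_simpl; ring]).
Qed.

(** On the right half-plane the argument is an arctangent, which is the form
    that can be differentiated. *)
Lemma Carg_atan (z : C) : 0 < Re z -> Carg z = atan (Im z / Re z).
Proof.
  intros Hz. unfold Carg.
  assert (Hm : 0 < Cmod z) by (apply Cmod_gt_0, Re_pos_neq_0, Hz).
  assert (E : sqrt (1 - (Re z / Cmod z)²) / (Re z / Cmod z) = Rabs (Im z) / Re z).
  { replace (1 - (Re z / Cmod z)²) with ((Rabs (Im z) / Cmod z) ^ 2).
    - rewrite sqrt_pow2.
      + field; lra.
      + apply Rdiv_le_0_compat; auto using Rabs_pos.
    - generalize (Cmod2_alt z). intros E.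
      apply Rmult_eq_reg_r with (Cmod z ^ 2); [|apply pow_nonzero; lra].
      unfold Rsqr. replace ((Rabs (Im z) / Cmod z) ^ 2 * Cmod z ^ 2) with (Rabs (Im z) ^ 2)
        by (field; lra).
      rewrite pow2_abs.
      replace ((1 - Re z / Cmod z * (Re z / Cmod z)) * Cmod z ^ 2) with (Cmod z ^ 2 - Re z ^ 2)
        by (field; lra). lra. }
  destruct (Rle_dec 0 (Im z)) as [Hi|Hi]; rewrite acos_atan, E
    by (apply Rdiv_lt_0_compat; auto).
  - now rewrite Rabs_pos_eq.
  - rewrite Rabs_left by lra. rewrite <- atan_opp. f_equal. field; lra.
Qed.

Lemma Clog_atan (z : C) : 0 < Re z -> Clog z = (ln (Cmod z), atan (Im z / Re z)).
Proof. intros H; unfold Clog; now rewrite Carg_atan. Qed.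

Lemma Clog_RtoC (r : R) : 0 < r -> Clog (RtoC r) = RtoC (ln r).
Proof.
  intros H. rewrite Clog_atan by exact H. rewrite Cmod_R, Rabs_pos_eq by lra.
  unfold RtoC; f_equal. c_simpl. replace (0 / r) with 0 by (field; lra). apply atan_0.
Qed.

Lemma Cexp_Clog (z : C) : 0 < Re z -> Cexp (Clog z) = z.
Proof.
  intros Hz. rewrite Clog_atan by assumption.
  assert (Hm : 0 < Cmod z) by (apply Cmod_gt_0, Re_pos_neq_0, Hz).
  assert (Hs : sqrt (1 + (Im z / Re z)²) = Cmod z / Re z).
  { rewrite <- (sqrt_pow2 (Cmod z / Re z)).
    - f_equal. apply Rmult_eq_reg_r with (Re z ^ 2); [|apply pow_nonzero; lra].
      replace ((Cmod z / Re z) ^ 2 * Re z ^ 2) with (Cmod z ^ 2) by (field; lra).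
      rewrite Cmod2_alt. unfold Rsqr; field; lra.
    - apply Rdiv_le_0_compat; lra. }
  apply C_ext.
  - change (exp (ln (Cmod z)) * cos (atan (Im z / Re z)) = Re z).
    rewrite exp_ln, cos_atan, Hs by assumption. field; lra.
  - change (exp (ln (Cmod z)) * sin (atan (Im z / Re z)) = Im z).
    rewrite exp_ln, sin_atan, Hs by assumption. field; lra.
Qed.

Lemma Clog_Re_ln (z : C) : Re (Clog z) = ln (Cmod z).
Proof. reflexivity. Qed.

Lemma Clog_Im_bound (z : C) : 0 < Re z -> Rabs (Im (Clog z)) <= 2.
Proof.
  intros H. rewrite Clog_atan by assumption.
  change (Rabs (atan (Im z / Re z)) <= 2).
  generalize (atan_bound (Im z / Re z)) PI_4. intros [h1 h2] h3.
  apply Rabs_le. lra.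
Qed.

Lemma path_derive_Clog_shift (x : C) (y : R) :
  0 < y + Re x ->
  is_path_derive (fun u => Clog (RtoC u + x)) y (/ (RtoC y + x))%C.
Proof.
  destruct x as [a b]. cbv [Re fst]. intros H.
  assert (Hl : locally y (fun u => 0 < u + a)).
  {    assert (Hc : continuous (fun u => u + a) y).
    { apply (continuous_plus (V := R_NormedModule));
        [apply continuous_id | apply continuous_const]. }
    apply (Hc (fun v => 0 < v)). apply open_gt. exact H. }
  split.
  - apply (is_derive_ext_loc (fun u => / 2 * ln ((u + a) ^ 2 + b ^ 2))).
    + revert Hl; apply filter_imp; intros u Hu.
      rewrite Clog_Re_ln. unfold Cmod; c_simpl.
      rewrite <- Rpower_sqrt by nra. unfold Rpower. rewrite ln_exp.
      f_equal. f_equal. ring.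
    + auto_derive; [simpl; nra|]. c_simpl. field. nra.
  - apply (is_derive_ext_loc (fun u => atan (b / (u + a)))).
    + revert Hl; apply filter_imp; intros u Hu.
      rewrite Clog_atan by exact Hu. c_simpl. f_equal; f_equal; ring.
    + auto_derive; [lra|]. c_simpl. unfold Rsqr. field. split; nra.
Qed.

(** * Euler summation of alternating series *)

Definition alternating (g : nat -> C) (m : nat) : C := (RtoC ((-1) ^ m) * g m)%C.

Definition fdiff (g : nat -> C) (m : nat) : C := (g m - g (S m))%C.

Fixpoint fdiff_iter (n : nat) (g : nat -> C) : nat -> C :=
  match n with O => g | S k => fdiff_iter k (fdiff g) end.

(** [l] is the value given to the divergent series [sum (-1)^m g m] when
    [sum (-1)^m g m = (g 0 + sum (-1)^m (g m - g (m+1))) / 2] is used [n] times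
    before summing in the ordinary sense. *)
Fixpoint Euler_sum (n : nat) (g : nat -> C) (l : C) : Prop :=
  match n with
  | O => C_is_series (alternating g) l
  | S k => Euler_sum k (fdiff g) (RtoC 2 * l - g O)%C
  end.

Lemma Rabs_pow_m1 (n : nat) : Rabs ((-1) ^ n) = 1.
Proof. rewrite <- RPow_abs, Rabs_left by lra. replace (- (-1)) with 1 by ring. apply pow1. Qed.

Lemma Cmod_alternating (g : nat -> C) (m : nat) : Cmod (alternating g m) = Cmod (g m).
Proof. unfold alternating. rewrite Cmod_mult, Cmod_R, Rabs_pow_m1. ring. Qed.

Lemma C_is_series_ext (u v : nat -> C) (l : C) :
  (forall n, u n = v n) -> C_is_series u l -> C_is_series v l.
Proof. intros H; apply is_series_ext; exact H. Qed.

Lemma C_is_series_unique (u : nat -> C) (l m : C) :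
  C_is_series u l -> C_is_series u m -> l = m.
Proof. rewrite !C_is_series_lim. apply C_lim_seq_unique. Qed.

Lemma C_is_series_term_lim (u : nat -> C) (l : C) :
  C_is_series u l -> C_lim_seq u (RtoC 0).
Proof.
  intros H. apply C_is_series_lim in H.
  assert (H' : C_lim_seq (fun n => Csum u (S n)) l).
  { apply (is_lim_seq_incr_1 (fun n => Cmod (Csum u n - l))). exact H. }
  generalize (C_lim_seq_minus _ _ _ _ H' H).
  replace (l - l)%C with (RtoC 0) by ring.
  apply C_lim_seq_ext. intros n; simpl. ring.
Qed.

Lemma C_lim_seq_Cmod_0 (u v : nat -> C) :
  (forall n, Cmod (u n) = Cmod (v n)) -> C_lim_seq u (RtoC 0) -> C_lim_seq v (RtoC 0).
Proof.
  intros H. unfold C_lim_seq. apply is_lim_seq_ext. intros n.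
  replace (u n - 0)%C with (u n) by ring. replace (v n - 0)%C with (v n) by ring. apply H.
Qed.

(** The boundary term [alternating g n] tends to 0 exactly when [g] does; this is
    what makes one Euler step harmless, in both directions, for null sequences. *)
Lemma Csum_alternating_fdiff (g : nat -> C) (n : nat) :
  Csum (alternating (fdiff g)) n =
  (RtoC 2 * Csum (alternating g) n - g O + alternating g n)%C.
Proof.
  induction n as [|n IH].
  - unfold alternating; simpl. ring.
  - simpl Csum. rewrite IH. unfold alternating, fdiff. simpl pow.
    rewrite RtoC_mult. ring.
Qed.

Lemma Euler_sum_ext (n : nat) (g h : nat -> C) (l : C) :
  (forall m, g m = h m) -> Euler_sum n g l -> Euler_sum n h l.
Proof. intros H. replace h with g; auto. now apply functional_extensionality. Qed.

(** The terms of a convergent series tend to 0, so the boundary term of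
    [Csum_alternating_fdiff] disappears in the limit. *)
Lemma Euler_sum_step (n : nat) (g : nat -> C) (l : C) :
  Euler_sum n g l -> Euler_sum (S n) g l.
Proof.
  revert g l. induction n as [|n IH]; intros g l H.
  - simpl in *. assert (H0 := C_is_series_term_lim _ _ H).
    apply C_is_series_lim in H. apply C_is_series_lim.
    apply (C_lim_seq_ext _ _ _ (fun n => eq_sym (Csum_alternating_fdiff g n))).
    replace (2 * l - g O)%C with (2 * l - g O + RtoC 0)%C by ring.
    apply C_lim_seq_plus; auto.
    apply C_lim_seq_minus; [apply C_lim_seq_scal; exact H | apply C_lim_seq_const].
  - exact (IH _ _ H).
Qed.

Lemma Euler_sum_le (n p : nat) (g : nat -> C) (l : C) :
  (n <= p)%nat -> Euler_sum n g l -> Euler_sum p g l.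
Proof. intros H; induction H; auto using Euler_sum_step. Qed.

(** Both values persist up to the common order [n + p], where they are ordinary
    sums of the same series. *)
Lemma Euler_sum_unique (n p : nat) (g : nat -> C) (l m : C) :
  Euler_sum n g l -> Euler_sum p g m -> l = m.
Proof.
  intros H1 H2.
  apply (Euler_sum_le n (n + p)) in H1; [|lia].
  apply (Euler_sum_le p (n + p)) in H2; [|lia].
  revert g l m H1 H2. induction (n + p)%nat as [|q IH]; intros g l m H1 H2.
  - eapply C_is_series_unique; eassumption.
  - assert (E := IH _ _ _ H1 H2).
    replace l with ((RtoC 2 * l - g O + g O) / RtoC 2)%C by field.
    rewrite E. field.
Qed.

Lemma Euler_sum_linear (n : nat) (g h : nat -> C) (c l m : C) :
  Euler_sum n g l -> Euler_sum n h m ->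
  Euler_sum n (fun k => g k + c * h k)%C (l + c * m)%C.
Proof.
  revert g h l m. induction n as [|n IH]; intros g h l m H1 H2.
  - simpl in *. rewrite C_is_series_lim in *.
    apply C_lim_seq_ext with
      (fun k => Csum (alternating g) k + c * Csum (alternating h) k)%C.
    + induction n as [|n IH]; simpl; [ring|]. rewrite <- IH. unfold alternating; ring.
    + apply C_lim_seq_plus; auto using C_lim_seq_scal.
  - simpl in *.
    replace (2 * (l + c * m) - (g O + c * h O))%C
      with ((2 * l - g O) + c * (2 * m - h O))%C by ring.
    apply Euler_sum_ext with (2 := IH _ _ _ _ H1 H2).
    intros k; unfold fdiff; ring.
Qed.

Lemma C_lim_seq_fdiff (d : nat -> C) :
  C_lim_seq d (RtoC 0) -> C_lim_seq (fdiff d) (RtoC 0).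
Proof.
  intros H. replace (RtoC 0) with (RtoC 0 - RtoC 0)%C by ring.
  apply C_lim_seq_minus; auto.
  apply (is_lim_seq_incr_1 (fun n => Cmod (d n - 0))). exact H.
Qed.

(** The converse of [Euler_sum_step] for null sequences, one step at a time:
    the differences of a null sequence form a null sequence. *)
Lemma Euler_sum_regular (n : nat) (d : nat -> C) (l : C) :
  C_lim_seq d (RtoC 0) -> Euler_sum n d l -> C_is_series (alternating d) l.
Proof.
  revert d l. induction n as [|n IH]; intros d l Hd H; auto.
  simpl in H. apply IH in H; [|now apply C_lim_seq_fdiff].
  apply C_is_series_lim in H. apply C_is_series_lim.
  apply C_lim_seq_ext with
    (fun k => / 2 * (Csum (alternating (fdiff d)) k + d O - alternating d k))%C.
  { intros k. rewrite Csum_alternating_fdiff. field. }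
  replace l with (/ 2 * (2 * l - d O + d O - 0))%C by field.
  apply C_lim_seq_scal. apply C_lim_seq_minus.
  - apply C_lim_seq_plus; auto using C_lim_seq_const.
  - apply C_lim_seq_Cmod_0 with d; auto. intros; now rewrite Cmod_alternating.
Qed.

(** A weight of the size of [m^(-2)] whose series telescopes, with sum 1. *)
Definition telescopic_weight (m : nat) : R := / ((INR m + 1) * (INR m + 2)).

Lemma Csum_telescopic_bound (u : nat -> C) (B : R) :
  (forall m, Cmod (u m) <= B * telescopic_weight m) ->
  forall n, Cmod (Csum u n) <= B * (1 - / (INR n + 1)).
Proof.
  intros H. induction n as [|n IH].
  - simpl. rewrite Cmod_0. apply Req_le. field.
  - simpl Csum. eapply Rle_trans; [apply Cmod_triangle|].
    eapply Rle_trans; [apply Rplus_le_compat; [apply IH | apply H]|].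
    apply Req_le. unfold telescopic_weight. rewrite S_INR.
    assert (P := pos_INR n). field. lra.
Qed.

(** At each step the value is the mean of the first term and of the next value,
    so a common bound is never worsened. *)
Lemma Euler_sum_bound (n : nat) (r : nat -> C) (l : C) (B : R) :
  (forall i, (i < n)%nat -> Cmod (fdiff_iter i r O) <= B) ->
  (forall m, Cmod (fdiff_iter n r m) <= B * telescopic_weight m) ->
  Euler_sum n r l -> Cmod l <= B.
Proof.
  revert r l. induction n as [|n IH]; intros r l H1 H2 H.
  - simpl in *. apply C_is_series_lim in H.
    apply (C_lim_seq_Cmod_le _ _ B H). intros n.
    assert (HB : 0 <= B).
    { generalize (Rle_trans _ _ _ (Cmod_ge_0 (r O)) (H2 O)).
      unfold telescopic_weight; simpl. lra. }
    eapply Rle_trans.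
    + apply Csum_telescopic_bound. intros m. rewrite Cmod_alternating. apply H2.
    + assert (P := pos_INR n). assert (0 < / (INR n + 1)) by (apply Rinv_0_lt_compat; lra).
      nra.
  - simpl in H. assert (H3 := H1 O (Nat.lt_0_succ n)). simpl in H3.
    assert (H4 : Cmod (2 * l - r O) <= B).
    { apply (IH (fdiff r)); auto. intros i Hi. apply (H1 (S i)). lia. }
    replace l with (/ 2 * ((2 * l - r O) + r O))%C by field.
    rewrite Cmod_mult.
    replace (Cmod (/ 2)) with (/ 2)
      by (rewrite Cmod_inv by (intros E; apply RtoC_inj in E; lra);
          rewrite Cmod_R, Rabs_pos_eq; lra).
    generalize (Cmod_triangle (2 * l - r O) (r O)). lra.
Qed.

Lemma ex_series_telescopic : ex_series telescopic_weight.
Proof.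
  exists 1. change (is_lim_seq (sum_n telescopic_weight) 1).
  apply is_lim_seq_ext with (fun n => 1 - / (INR n + 2)).
  - induction n as [|n IH].
    + rewrite sum_O. unfold telescopic_weight; simpl. field.
    + rewrite sum_Sn, <- IH. unfold plus, telescopic_weight; simpl plus.
      cbn -[INR]. rewrite S_INR. assert (P := pos_INR n). field. lra.
  - replace (Finite 1) with (Finite (1 - 0)) by (f_equal; ring).
    apply is_lim_seq_minus'; [apply is_lim_seq_const|].
    apply (is_lim_seq_inv (fun n => INR n + 2) p_infty); [|discriminate].
    apply is_lim_seq_plus with (l1 := p_infty) (l2 := Finite 2);
      auto using is_lim_seq_INR, is_lim_seq_const.
    reflexivity.
Qed.

Lemma ex_C_series_telescopic (u : nat -> C) (B : R) :
  (forall m, Cmod (u m) <= B * telescopic_weight m) -> exists l, C_is_series u l.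
Proof.
  intros H.
  assert (K : forall p : C -> R, (forall z, Rabs (p z) <= Cmod z) -> ex_series (fun m => p (u m))).
  { intros p Hp. apply (ex_series_le (V := R_CompleteNormedModule))
      with (b := fun m => B * telescopic_weight m).
    - intros m. eapply Rle_trans; [apply Hp | apply H].
    - apply (ex_series_scal (V := R_NormedModule) B). apply ex_series_telescopic. }
  destruct (K Re re_le_Cmod) as [a Ha]. destruct (K Im Im_le_Cmod) as [b Hb].
  exists (a, b). apply C_is_series_lim.
  apply (is_lim_seq_incr_1 (fun n => Cmod (Csum u n - (a, b)))).
  apply (C_lim_seq_components (fun n => Csum u (S n)) (a, b)). split.
  - apply is_lim_seq_ext with (2 := Ha). induction n as [|n IH].
    + rewrite sum_O. c_simpl. ring.
    + rewrite sum_Sn, IH. reflexivity.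
  - apply is_lim_seq_ext with (2 := Hb). induction n as [|n IH].
    + rewrite sum_O. c_simpl. ring.
    + rewrite sum_Sn, IH. reflexivity.
Qed.

Lemma ex_Euler_sum (n : nat) (g : nat -> C) (B : R) :
  (forall m, Cmod (fdiff_iter n g m) <= B * telescopic_weight m) ->
  exists l, Euler_sum n g l.
Proof.
  revert g. induction n as [|n IH]; intros g H.
  - apply ex_C_series_telescopic with B. intros m. rewrite Cmod_alternating. apply H.
  - destruct (IH (fdiff g) H) as [l Hl]. exists ((l + g O) / 2)%C. simpl.
    replace (2 * ((l + g O) / 2) - g O)%C with l by field. exact Hl.
Qed.

(** * Iterated differences of log-powers *)

Definition log_power (x : C) (j : nat) (s : C) (y : R) : C :=
  (Clog (RtoC y + x) ^ j * Cpower (RtoC y + x) (- s))%C.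

Lemma path_derive_Cpow (f : R -> C) (t : R) (l : C) (j : nat) :
  is_path_derive f t l ->
  is_path_derive (fun u => f u ^ j)%C t (RtoC (INR j) * f t ^ pred j * l)%C.
Proof.
  intros H. induction j as [|j IH].
  - eapply path_derive_eq; [apply (path_derive_const 1)|]. simpl. ring.
  - eapply path_derive_eq; [apply (path_derive_mult f (fun u => f u ^ j)%C); eassumption|].
    rewrite S_INR, RtoC_plus. destruct j; simpl; ring.
Qed.

Lemma Re_shift_pos (x : C) (y : R) : 0 < Re x -> 0 <= y -> 0 < Re (RtoC y + x).
Proof. intros H1 H2; c_simpl; lra. Qed.

(** Up to scalars the derivative stays in the family, with [s] raised by one;
    this drives the induction of [rdiff_log_power_bound]. *)
Lemma path_derive_log_power (x s : C) (j : nat) (y : R) :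
  0 < Re x -> 0 <= y ->
  is_path_derive (log_power x j s) y
    (RtoC (INR j) * log_power x (pred j) (s + 1) y - s * log_power x j (s + 1) y)%C.
Proof.
  intros Hx Hy. assert (Hp := Re_shift_pos x y Hx Hy).
  assert (HL : is_path_derive (fun u => Clog (RtoC u + x)) y (/ (RtoC y + x))%C).
  { apply path_derive_Clog_shift. lra. }
  eapply path_derive_eq.
  - apply (path_derive_mult (fun u => Clog (RtoC u + x) ^ j)%C
      (fun u => Cpower (RtoC u + x) (- s))).
    + apply path_derive_Cpow, HL.
    + apply path_derive_Cexp. apply (path_derive_scal (- s)), HL.
  - unfold log_power, Cpower. cbv beta.
    replace (- (s + 1) * Clog (RtoC y + x))%C
      with (- s * Clog (RtoC y + x) - Clog (RtoC y + x))%C by ring.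
    rewrite Cexp_minus, (Cexp_Clog _ Hp). field. now apply Re_pos_neq_0.
Qed.

Fixpoint rdiff_iter (k : nat) (g : R -> C) (y : R) : C :=
  match k with O => g y | S k => (rdiff_iter k g y - rdiff_iter k g (y + 1)%R)%C end.

Lemma fdiff_iter_rdiff_iter (k : nat) (g : R -> C) (m : nat) :
  fdiff_iter k (fun i => g (INR i)) m = rdiff_iter k g (INR m).
Proof.
  assert (E : forall k f (y : R), rdiff_iter k (fun u => f u - f (u + 1)%R)%C y
      = (rdiff_iter k f y - rdiff_iter k f (y + 1)%R)%C).
  { intros p f. induction p as [|p IH]; intros y; simpl; auto. rewrite !IH. ring. }
  revert g m. induction k as [|k IH]; intros g m; [reflexivity|].
  simpl. rewrite <- E, <- IH. f_equal. apply functional_extensionality. intros i.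
  unfold fdiff. now rewrite S_INR.
Qed.

Lemma rdiff_iter_linear (k : nat) (a b : C) (f g : R -> C) (y : R) :
  rdiff_iter k (fun u => a * f u - b * g u)%C y =
  (a * rdiff_iter k f y - b * rdiff_iter k g y)%C.
Proof.
  revert y. induction k as [|k IH]; intros y; simpl; auto. rewrite !IH. ring.
Qed.

Lemma path_derive_rdiff_iter (k : nat) (g g' : R -> C) :
  (forall y, 0 <= y -> is_path_derive g y (g' y)) ->
  forall y, 0 <= y -> is_path_derive (rdiff_iter k g) y (rdiff_iter k g' y).
Proof.
  intros H. induction k as [|k IH]; intros y Hy; simpl; auto.
  apply (path_derive_minus (rdiff_iter k g) (fun u => rdiff_iter k g (u + 1))); auto.
  eapply path_derive_eq.
  - apply (path_derive_comp (rdiff_iter k g) (fun u => u + 1) y 1).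
    + apply IH. lra.
    + auto_derive; auto.
  - ring.
Qed.

Lemma exp_le (a b : R) : a <= b -> exp a <= exp b.
Proof.
  intros H. destruct (Rle_lt_or_eq_dec _ _ H) as [Hl | <-];
    [left; now apply exp_increasing | apply Rle_refl].
Qed.

Lemma exp_mult_INR (n : nat) (v : R) : exp (INR n * v) = exp v ^ n.
Proof.
  induction n as [|n IH]; [simpl; rewrite Rmult_0_l; apply exp_0|].
  rewrite S_INR, Rmult_plus_distr_r, exp_plus, IH. simpl. rewrite Rmult_1_l. ring.
Qed.

(** Take the [j]-th power of [v / (2 j) <= exp (v / (2 j))]. *)
Lemma ln_pow_le_exp (j : nat) (v : R) : 0 <= v -> v ^ j <= (2 * INR j) ^ j * exp (v / 2).
Proof.
  intros Hv. destruct j as [|j].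
  - simpl. generalize (exp_ineq1_le (v / 2)). lra.
  - set (q := INR (S j)). assert (Hq : 0 < q) by (apply lt_0_INR; lia).
    replace (exp (v / 2)) with (exp (v / (2 * q)) ^ S j).
    + rewrite <- Rpow_mult_distr. apply pow_incr. split; auto.
      generalize (exp_ineq1_le (v / (2 * q))). intros H.
      replace v with (2 * q * (v / (2 * q))) at 1 by (field; lra).
      apply Rmult_le_compat_l; lra.
    + rewrite <- exp_mult_INR. f_equal. fold q. field. lra.
Qed.

Lemma ln_Cmod_shift (x : C) : 0 < Re x ->
  exists K, 0 <= K /\ forall y, 0 <= y -> Rabs (ln (Cmod (RtoC y + x)) - ln (1 + y)) <= K.
Proof.
  intros Hx. set (a := Re x) in *.
  assert (Hm : 0 <= Cmod x) by apply Cmod_ge_0.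
  assert (K1 : 0 <= ln (1 + Cmod x)).
  { rewrite <- ln_1. apply ln_le; lra. }
  assert (K2 : 0 <= ln ((1 + a) / a)).
  { rewrite <- ln_1. apply ln_le; [lra|].
    apply Rmult_le_reg_r with a; auto. unfold Rdiv; rewrite Rmult_assoc, Rinv_l; lra. }
  exists (ln (1 + Cmod x) + ln ((1 + a) / a)). split; [lra|]. intros y Hy.
  assert (Hp := Re_shift_pos x y Hx Hy).
  assert (Hc : 0 < Cmod (RtoC y + x)) by (apply Cmod_gt_0, Re_pos_neq_0, Hp).
  assert (U : ln (Cmod (RtoC y + x)) <= ln (1 + Cmod x) + ln (1 + y)).
  { rewrite <- ln_mult by lra. apply ln_le; auto.
    eapply Rle_trans; [apply Cmod_triangle|]. rewrite Cmod_R, Rabs_pos_eq by lra. nra. }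
  assert (V : ln (1 + y) <= ln ((1 + a) / a) + ln (Cmod (RtoC y + x))).
  { rewrite <- ln_mult by (auto; apply Rdiv_lt_0_compat; lra). apply ln_le; [lra|].
    assert (Hr : y + a <= Cmod (RtoC y + x)).
    { replace (y + a) with (Re (RtoC y + x)) by (unfold a; c_simpl; ring).
      apply Cmod_Re_pos; lra. }
    apply Rle_trans with ((1 + a) / a * (y + a)).
    - apply Rmult_le_reg_r with a; auto.
      replace ((1 + a) / a * (y + a) * a) with ((1 + a) * (y + a)) by (field; lra). nra.
    - apply Rmult_le_compat_l; auto. left; apply Rdiv_lt_0_compat; lra. }
  apply Rabs_le. lra.
Qed.

Lemma Re_le_of_Cmod (s : C) (r : R) : Cmod s <= r -> Rabs (Re s) <= r /\ Rabs (Im s) <= r.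
Proof. generalize (re_le_Cmod s) (Im_le_Cmod s). lra. Qed.

Lemma Rmult_le_abs (u v a b : R) : Rabs u <= a -> Rabs v <= b -> u * v <= a * b.
Proof.
  intros H1 H2. eapply Rle_trans; [apply Rle_abs|]. rewrite Rabs_mult.
  apply Rmult_le_compat; auto using Rabs_pos.
Qed.

Lemma Cmod_Cpower_shift (x : C) : 0 < Re x ->
  exists K, 0 <= K /\ forall s y r, Cmod s <= r -> 0 <= y ->
    Cmod (Cpower (RtoC y + x) (- s)) <= exp (r * K) * exp (- Re s * ln (1 + y)).
Proof.
  intros Hx. destruct (ln_Cmod_shift x Hx) as [K [HK H]].
  exists (K + 2). split; [lra|]. intros s y r Hs Hy.
  destruct (Re_le_of_Cmod _ _ Hs) as [Hs1 Hs2].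
  assert (Hp := Re_shift_pos x y Hx Hy).
  unfold Cpower. rewrite Cmod_Cexp, <- exp_plus.
  set (L := Clog (RtoC y + x)).
  replace (Re (- s * L)) with (- Re s * Re L + Im s * Im L) by (c_simpl; ring).
  assert (I := Clog_Im_bound _ Hp). fold L in I.
  assert (E : Re L = (Re L - ln (1 + y)) + ln (1 + y)) by ring.
  assert (J := H y Hy). change (ln (Cmod (RtoC y + x))) with (Re L) in J.
  rewrite <- Rabs_Ropp in Hs1.
  assert (T1 := Rmult_le_abs _ _ _ _ Hs1 J).
  assert (T2 := Rmult_le_abs _ _ _ _ Hs2 I).
  assert (- Re s * Re L + Im s * Im L <= r * (K + 2) + - Re s * ln (1 + y)) by nra.
  apply exp_le. lra.
Qed.

Lemma log_power_bound (x : C) (j : nat) (r : R) : 0 < Re x ->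
  exists B, 0 <= B /\ forall s y, Cmod s <= r -> 0 <= y ->
    Cmod (log_power x j s y) <= B * exp ((1 / 2 - Re s) * ln (1 + y)).
Proof.
  intros Hx. destruct (ln_Cmod_shift x Hx) as [K [HK H]].
  destruct (Cmod_Cpower_shift x Hx) as [K' [HK' H']].
  exists ((2 * INR j) ^ j * exp ((K + 2) / 2) * exp (r * K')).
  assert (P0 : 0 <= (2 * INR j) ^ j) by (apply pow_le; generalize (pos_INR j); lra).
  split.
  { repeat apply Rmult_le_pos; auto; left; apply exp_pos. }
  intros s y Hs Hy. unfold log_power. rewrite Cmod_mult, Cmod_pow.
  assert (Hl : 0 <= ln (1 + y)) by (rewrite <- ln_1; apply ln_le; lra).
  assert (Hp := Re_shift_pos x y Hx Hy).
  set (v := ln (1 + y) + K + 2).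
  assert (T : Cmod (Clog (RtoC y + x)) <= v).
  { eapply Rle_trans; [apply Cmod_le_abs|].
    assert (I := Clog_Im_bound _ Hp). assert (J := H y Hy).
    change (ln (Cmod (RtoC y + x))) with (Re (Clog (RtoC y + x))) in J.
    assert (Rabs (Re (Clog (RtoC y + x))) <= K + ln (1 + y)).
    { replace (Re (Clog (RtoC y + x))) with
        ((Re (Clog (RtoC y + x)) - ln (1 + y)) + ln (1 + y)) by ring.
      eapply Rle_trans; [apply Rabs_triang|]. rewrite (Rabs_pos_eq (ln (1 + y))) by auto. lra. }
    unfold v. lra. }
  apply Rle_trans with (((2 * INR j) ^ j * exp (v / 2)) *
     (exp (r * K') * exp (- Re s * ln (1 + y)))).
  - apply Rmult_le_compat; auto using Cmod_ge_0, pow_le.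
    eapply Rle_trans; [apply pow_incr; split; [apply Cmod_ge_0 | exact T]|].
    apply ln_pow_le_exp. unfold v; lra.
  - apply Req_le. unfold v.
    replace ((1 / 2 - Re s) * ln (1 + y)) with (ln (1 + y) / 2 + - Re s * ln (1 + y)) by field.
    replace ((ln (1 + y) + K + 2) / 2) with (ln (1 + y) / 2 + (K + 2) / 2) by field.
    rewrite !exp_plus. ring.
Qed.

Lemma exp_ln_shift_le (p q y t : R) :
  0 <= y -> y <= t <= y + 1 -> Rabs p <= q ->
  exp (p * ln (1 + t)) <= exp q * exp (p * ln (1 + y)).
Proof.
  intros Hy Ht Hp. rewrite <- exp_plus. apply exp_le.
  assert (H1 : ln (1 + y) <= ln (1 + t)) by (apply ln_le; lra).
  assert (H2 : ln (1 + t) <= ln (1 + y) + 1).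
  { apply Rle_trans with (ln (2 * (1 + y))); [apply ln_le; lra|].
    rewrite ln_mult by lra. generalize ln_lt_2 (exp_ineq1_le 1). intros _ E.
    assert (ln 2 <= 1).
    { rewrite <- (ln_exp 1). apply ln_le; lra. }
    lra. }
  assert (E : p * (ln (1 + t) - ln (1 + y)) <= q * 1).
  { apply Rmult_le_abs; auto. rewrite Rabs_pos_eq; lra. }
  lra.
Qed.

(** A difference at [y] is bounded by a derivative between [y] and [y + 1], and
    a derivative replaces [s] by [s + 1]: each difference gains one power of
    [1 + y]. The 1/2 in the exponent pays for the powers of the logarithm. *)
Lemma rdiff_log_power_bound (x : C) (k j : nat) (r : R) : 0 < Re x ->
  exists B, 0 <= B /\ forall s y, Cmod s <= r -> 0 <= y ->
    Cmod (rdiff_iter k (log_power x j s) y) <= B * exp ((1 / 2 - Re s - INR k) * ln (1 + y)).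
Proof.
  intros Hx. revert j r. induction k as [|k IH]; intros j r.
  - destruct (log_power_bound x j r Hx) as [B [HB H]]. exists B. split; auto.
    intros s y Hs Hy. simpl. rewrite Rminus_0_r. now apply H.
  - destruct (IH (pred j) (r + 1)) as [B1 [HB1 H1]].
    destruct (IH j (r + 1)) as [B2 [HB2 H2]].
    set (r' := Rabs r). assert (Hr' : 0 <= r') by apply Rabs_pos.
    exists (2 * ((INR j * B1 + r' * B2) * exp (r' + 1 + INR k))).
    assert (HB : 0 <= INR j * B1 + r' * B2).
    { apply Rplus_le_le_0_compat; apply Rmult_le_pos; auto using pos_INR. }
    split.
    { apply Rmult_le_pos; [lra|]. apply Rmult_le_pos; auto. left; apply exp_pos. }
    intros s y Hs Hy.
    assert (Hsr : Cmod s <= r') by (eapply Rle_trans; [exact Hs | apply Rle_abs]).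
    assert (Hs1 : Cmod (s + 1) <= r + 1).
    { eapply Rle_trans; [apply Cmod_triangle|]. rewrite Cmod_1. lra. }
    simpl rdiff_iter. rewrite Cmod_sub_sym.
    set (h' := rdiff_iter k (fun u => RtoC (INR j) * log_power x (pred j) (s + 1) u
                     - s * log_power x j (s + 1) u)%C).
    eapply Rle_trans.
    { apply (path_mean_value (rdiff_iter k (log_power x j s)) h' y (y + 1)
        ((INR j * B1 + r' * B2) * exp (r' + 1 + INR k)
          * exp ((1 / 2 - Re s - INR (S k)) * ln (1 + y)))); [lra| |].
      - intros t Ht. apply path_derive_rdiff_iter; [|lra].
        intros u Hu. now apply path_derive_log_power.
      - intros t Ht. unfold h'. rewrite rdiff_iter_linear.
        set (p := 1 / 2 - Re s - INR (S k)).
        assert (Ep : 1 / 2 - Re (s + 1) - INR k = p).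
        { unfold p. rewrite S_INR. c_simpl. ring. }
        assert (G1 := H1 (s + 1)%C t Hs1 ltac:(lra)). rewrite Ep in G1.
        assert (G2 := H2 (s + 1)%C t Hs1 ltac:(lra)). rewrite Ep in G2.
        assert (G3 : exp (p * ln (1 + t)) <= exp (r' + 1 + INR k) * exp (p * ln (1 + y))).
        { apply exp_ln_shift_le; auto. destruct (Re_le_of_Cmod _ _ Hsr) as [Q _].
          apply Rabs_le_between in Q. assert (Pk := pos_INR k).
          unfold p. rewrite S_INR. apply Rabs_le. lra. }
        apply Rle_trans with ((INR j * B1 + r' * B2) * exp (p * ln (1 + t))).
        + eapply Rle_trans; [apply Cmod_minus_le|].
          rewrite !Cmod_mult, Cmod_R, (Rabs_pos_eq (INR j)) by apply pos_INR.
          rewrite Rmult_plus_distr_r, !Rmult_assoc. apply Rplus_le_compat.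
          * apply Rmult_le_compat_l; auto using pos_INR.
          * apply Rmult_le_compat; auto using Cmod_ge_0.
        + rewrite Rmult_assoc. apply Rmult_le_compat_l; auto. }
    apply Req_le. ring.
Qed.

(** * The entire continuation *)

Lemma fdiff_iter_scal (n : nat) (c : C) (g : nat -> C) (m : nat) :
  fdiff_iter n (fun i => c * g i)%C m = (c * fdiff_iter n g m)%C.
Proof.
  revert g m. induction n as [|n IH]; intros g m; [reflexivity|].
  simpl. rewrite <- IH. f_equal. apply functional_extensionality. intros i.
  unfold fdiff. ring.
Qed.

Lemma fdiff_iter_zero (n : nat) (m : nat) : fdiff_iter n (fun _ => RtoC 0) m = RtoC 0.
Proof.
  revert m. induction n as [|n IH]; intros m; [reflexivity|].
  simpl. etransitivity; [|apply (IH m)]. f_equal. apply functional_extensionality. intros i.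
  unfold fdiff. ring.
Qed.

Lemma path_derive_fdiff_iter (n : nat) (G G' : R -> nat -> C) (t : R) :
  (forall i, is_path_derive (fun u => G u i) t (G' t i)) ->
  forall m, is_path_derive (fun u => fdiff_iter n (G u) m) t (fdiff_iter n (G' t) m).
Proof.
  revert G G'. induction n as [|n IH]; intros G G' H m; [apply H|].
  simpl. apply (IH (fun u => fdiff (G u)) (fun u => fdiff (G' u))).
  intros i. unfold fdiff. apply path_derive_minus; apply H.
Qed.

Definition log_powers (x : C) (j : nat) (s : C) (m : nat) : C := log_power x j s (INR m).

(** For [n > r + 3] the exponent [1/2 - Re s - n] of [rdiff_log_power_bound] is
    at most -2 on the whole disc [Cmod s <= r]. *)
Lemma log_powers_bounds (x : C) (r : R) : 0 < Re x ->
  exists n, forall j, exists B, forall s, Cmod s <= r ->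
    (forall m, Cmod (fdiff_iter n (log_powers x j s) m) <= B * telescopic_weight m) /\
    (forall i, (i < n)%nat -> Cmod (fdiff_iter i (log_powers x j s) O) <= B).
Proof.
  intros Hx. destruct (INR_archimed 1 (r + 3)) as [n Hn]; [lra|]. rewrite Rmult_1_r in Hn.
  exists n. intros j.
  assert (K : forall k, exists B, 0 <= B /\ forall i, (i < k)%nat -> forall s, Cmod s <= r ->
     Cmod (fdiff_iter i (log_powers x j s) O) <= B).
  { induction k as [|k IH].
    - exists 0. split; [lra|]. intros; lia.
    - destruct IH as [B1 [HB1 H1]]. destruct (rdiff_log_power_bound x k j r Hx) as [B2 [HB2 H2]].
      exists (B1 + B2). split; [lra|]. intros i Hi s Hs.
      destruct (Nat.eq_dec i k) as [->|Hne].
      + unfold log_powers. rewrite fdiff_iter_rdiff_iter.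
        generalize (H2 s 0 Hs (Rle_refl 0)). rewrite Rplus_0_r, ln_1, Rmult_0_r, exp_0.
        simpl INR. lra.
      + generalize (H1 i ltac:(lia) s Hs). lra. }
  destruct (K n) as [B1 [HB1 H1]]. destruct (rdiff_log_power_bound x n j r Hx) as [B2 [HB2 H2]].
  exists (B1 + 2 * B2). intros s Hs. split.
  - intros m. unfold log_powers. rewrite fdiff_iter_rdiff_iter.
    assert (Pm := pos_INR m). eapply Rle_trans; [apply H2; auto|].
    destruct (Re_le_of_Cmod _ _ Hs) as [Q _]. apply Rabs_le_between in Q.
    assert (Hl : 0 <= ln (1 + INR m)) by (rewrite <- ln_1; apply ln_le; lra).
    assert (E1 : exp ((1 / 2 - Re s - INR n) * ln (1 + INR m)) <= / (1 + INR m) ^ 2).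
    { apply Rle_trans with (exp (- (INR 2 * ln (1 + INR m)))).
      - apply exp_le. simpl INR. nra.
      - rewrite exp_Ropp, exp_mult_INR, exp_ln by lra. apply Rle_refl. }
    assert (E2 : / (1 + INR m) ^ 2 <= 2 * telescopic_weight m).
    { unfold telescopic_weight. apply Rmult_le_reg_l with ((1 + INR m) ^ 2 * (INR m + 2)); [nra|].
      replace ((1 + INR m) ^ 2 * (INR m + 2) * / (1 + INR m) ^ 2) with (INR m + 2) by (field; nra).
      replace ((1 + INR m) ^ 2 * (INR m + 2) * (2 * / ((INR m + 1) * (INR m + 2))))
        with (2 * (1 + INR m)) by (field; lra). lra. }
    assert (Hw : 0 <= telescopic_weight m).
    { unfold telescopic_weight. left. apply Rinv_0_lt_compat. nra. }
    nra.
  - intros i Hi. generalize (H1 i Hi s Hs). lra.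
Qed.

(** The second order Taylor remainder in [s] of the differences. The factor 4 is
    two applications of the mean value bound, one for each
    order of the Taylor expansion. *)
Lemma fdiff_iter_remainder (x s h : C) (j n m : nat) (B : R) : 0 < Re x ->
  (forall t, 0 <= t <= 1 ->
     Cmod (fdiff_iter n (log_powers x (S (S j)) (s + RtoC t * h)) m) <= B) ->
  Cmod (fdiff_iter n (fun i => (log_powers x j (s + h) i + (-1) * log_powers x j s i)
                        + h * log_powers x (S j) s i)%C m) <= 4 * Cmod h ^ 2 * B.
Proof.
  intros Hx HB.
  assert (D : forall k i t, is_path_derive (fun u => log_powers x k (s + RtoC u * h) i) t
      (- h * log_powers x (S k) (s + RtoC t * h) i)%C).
  { intros k i t. unfold log_powers, log_power, Cpower.
    set (L := Clog (RtoC (INR i) + x)).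
    eapply path_derive_eq.
    - apply (path_derive_scal (L ^ k)%C).
      apply (path_derive_Cexp (fun u => - (s + RtoC u * h) * L)%C t (- h * L)%C).
      apply path_derive_ext with (fun u => - s * L + (- h * L) * RtoC u)%C.
      { intros u; ring. }
      eapply path_derive_eq.
      + apply path_derive_plus; [apply path_derive_const|].
        apply path_derive_scal. apply (path_derive_RtoC (fun u => u) t 1).
        auto_derive; auto.
      + ring.
    - simpl. ring. }
  set (g := fun k t i => log_powers x k (s + RtoC t * h) i).
  set (P := fun t i => (g j t i + (-1) * log_powers x j s i
                        + RtoC t * (h * log_powers x (S j) s i))%C).
  set (P' := fun t i => (- h * (g (S j) t i - log_powers x (S j) s i))%C).
  set (P'' := fun t i => (h * h * g (S (S j)) t i)%C).
  assert (Hh : 0 <= Cmod h) by apply Cmod_ge_0.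
  assert (HB0 : 0 <= B) by (eapply Rle_trans; [apply Cmod_ge_0 | apply (HB 0); lra]).
  assert (E0 : s = (s + RtoC 0 * h)%C) by ring.
  assert (P0 : forall i, P 0 i = RtoC 0).
  { intros i. unfold P, g. rewrite <- E0. ring. }
  assert (P'0 : forall i, P' 0 i = RtoC 0).
  { intros i. unfold P', g. rewrite <- E0. ring. }
  assert (D1 : forall t i, is_path_derive (fun u => P u i) t (P' t i)).
  { intros t i. unfold P. eapply path_derive_eq.
    - apply path_derive_plus; [apply path_derive_plus; [apply D | apply path_derive_const]|].
      apply path_derive_mult; [|apply path_derive_const].
      apply (path_derive_RtoC (fun u => u) t 1). auto_derive; auto.
    - unfold P', g. ring. }
  assert (D2 : forall t i, is_path_derive (fun u => P' u i) t (P'' t i)).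
  { intros t i. unfold P'. eapply path_derive_eq.
    - apply path_derive_scal. apply path_derive_minus; [apply D | apply path_derive_const].
    - unfold P'', g. ring. }
  assert (B2 : forall t, 0 <= t <= 1 -> Cmod (fdiff_iter n (P'' t) m) <= Cmod h ^ 2 * B).
  { intros t Ht. unfold P''. rewrite fdiff_iter_scal, !Cmod_mult.
    replace (Cmod h ^ 2) with (Cmod h * Cmod h) by ring.
    apply Rmult_le_compat_l; [nra|]. now apply HB. }
  assert (B1 : forall t, 0 <= t <= 1 -> Cmod (fdiff_iter n (P' t) m) <= 2 * (Cmod h ^ 2 * B)).
  { intros t Ht.
    replace (fdiff_iter n (P' t) m) with (fdiff_iter n (P' t) m - fdiff_iter n (P' 0) m)%C.
    - eapply Rle_trans.
      + apply (path_mean_value (fun u => fdiff_iter n (P' u) m)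
          (fun u => fdiff_iter n (P'' u) m) 0 t (Cmod h ^ 2 * B)); [lra| |].
        * intros u Hu. apply path_derive_fdiff_iter. intros i; apply D2.
        * intros u Hu. apply B2. lra.
      + assert (0 <= Cmod h ^ 2 * B) by (apply Rmult_le_pos; auto; nra). nra.
    - replace (P' 0) with (fun _ : nat => RtoC 0)
        by (symmetry; apply functional_extensionality; exact P'0).
      rewrite fdiff_iter_zero. ring. }
  replace (fdiff_iter n _ m) with (fdiff_iter n (P 1) m - fdiff_iter n (P 0) m)%C.
  - eapply Rle_trans.
    + apply (path_mean_value (fun u => fdiff_iter n (P u) m)
        (fun u => fdiff_iter n (P' u) m) 0 1 (2 * (Cmod h ^ 2 * B))); [lra| |].
      * intros u Hu. apply path_derive_fdiff_iter. intros i; apply D1.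
      * intros u Hu. apply B1. lra.
    + apply Req_le. ring.
  - replace (P 0) with (fun _ : nat => RtoC 0)
      by (symmetry; apply functional_extensionality; exact P0).
    rewrite fdiff_iter_zero.
    replace (P 1) with (fun i => (log_powers x j (s + h) i + (-1) * log_powers x j s i)
                        + h * log_powers x (S j) s i)%C.
    + ring.
    + apply functional_extensionality; intros i. unfold P, g.
      replace (s + RtoC 1 * h)%C with (s + h)%C by ring. ring.
Qed.

Lemma is_derive_C_of_quadratic (f : C -> C) (z l : C) (K : R) :
  (forall h, Cmod h <= 1 -> Cmod (f (z + h) - f z - h * l)%C <= K * Cmod h ^ 2) ->
  @is_derive C_AbsRing C_NormedModule f z l.
Proof.
  intros H. split; [apply is_linear_scal_l|].
  intros y Hy.
  assert (E : y = z).
  { symmetry. apply (is_filter_lim_locally_unique (V := AbsRing_NormedModule C_AbsRing)). exact Hy. }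
  subst y. intros eps.
  assert (He := cond_pos eps).
  set (K' := Rabs K + 1). assert (HK : 0 < K') by (unfold K'; generalize (Rabs_pos K); lra).
  set (d := Rmin 1 (eps / K')).
  assert (Hd : 0 < d) by (apply Rmin_pos; [lra | now apply Rdiv_lt_0_compat]).
  exists (mkposreal d Hd). refine (fun (w : C) Hw => _).
  assert (Hw' : Cmod (w - z) < d) by exact Hw.
  change (Cmod ((f w - f z) - (w - z) * l)%C <= eps * Cmod (w - z)).
  assert (H1 : Cmod (w - z) <= 1) by (eapply Rle_trans; [left; exact Hw' | apply Rmin_l]).
  assert (H2 : Cmod (w - z) <= eps / K') by (eapply Rle_trans; [left; exact Hw' | apply Rmin_r]).
  assert (H3 := H (w - z)%C H1). replace (z + (w - z))%C with w in H3 by ring.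
  eapply Rle_trans; [exact H3|].
  assert (H0 := Cmod_ge_0 (w - z)). set (q := Cmod (w - z)) in *.
  apply Rle_trans with (K' * q * q).
  - assert (K <= K') by (unfold K'; generalize (Rle_abs K); lra). nra.
  - apply Rmult_le_compat_r; auto.
    apply Rmult_le_reg_l with (/ K'); [now apply Rinv_0_lt_compat|].
    replace (/ K' * (K' * q)) with q by (field; lra). unfold Rdiv in H2. lra.
Qed.

(** Up to the sign [(-1)^j], the [j]-th derivative in [s] of the alternating
    Hurwitz zeta function. *)
Definition eta_log (x : C) (j : nat) (s : C) : C :=
  epsilon (inhabits (RtoC 0)) (fun l => exists n, Euler_sum n (log_powers x j s) l).

(** One order of summation serves a whole disc, which is what termwise
    differentiation requires. *)
Lemma eta_log_spec (x : C) (r : R) : 0 < Re x ->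
  exists n, forall j s, Cmod s <= r -> Euler_sum n (log_powers x j s) (eta_log x j s).
Proof.
  intros Hx. destruct (log_powers_bounds x r Hx) as [n Hn]. exists n. intros j s Hs.
  destruct (Hn j) as [B HB]. destruct (HB s Hs) as [H _].
  destruct (ex_Euler_sum n _ B H) as [l Hl].
  destruct (epsilon_spec (inhabits (RtoC 0))
    (fun l => exists n, Euler_sum n (log_powers x j s) l)) as [p Hp]; [eauto|].
  fold (eta_log x j s) in Hp. now rewrite (Euler_sum_unique _ _ _ _ _ Hp Hl).
Qed.

(** Euler summation is linear, so the remainder of the first order Taylor
    expansion is the Euler sum of the termwise remainders, which
    [fdiff_iter_remainder] and [Euler_sum_bound] make quadratic in [h]. *)
Lemma is_derive_eta_log (x : C) (j : nat) (s : C) : 0 < Re x ->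
  @is_derive C_AbsRing C_NormedModule (eta_log x j) s (- eta_log x (S j) s)%C.
Proof.
  intros Hx.
  destruct (log_powers_bounds x (Cmod s + 1) Hx) as [n Hn].
  destruct (eta_log_spec x (Cmod s + 1) Hx) as [p Hp].
  destruct (Hn (S (S j))) as [B HB].
  apply is_derive_C_of_quadratic with (4 * B). intros h Hh.
  assert (S1 : Cmod s <= Cmod s + 1) by lra.
  assert (S2 : forall t, 0 <= t <= 1 -> Cmod (s + RtoC t * h) <= Cmod s + 1).
  { intros t Ht. eapply Rle_trans; [apply Cmod_triangle|].
    rewrite Cmod_mult, Cmod_R, Rabs_pos_eq by lra. generalize (Cmod_ge_0 h). nra. }
  assert (S3 : Cmod (s + h) <= Cmod s + 1).
  { generalize (S2 1 ltac:(lra)). now rewrite Cmult_1_l. }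
  assert (Hh0 := Cmod_ge_0 h).
  assert (HE : exists q, Euler_sum q (fun i => (log_powers x j (s + h) i + (-1) * log_powers x j s i)
                        + h * log_powers x (S j) s i)%C
     (eta_log x j (s + h) + (-1) * eta_log x j s + h * eta_log x (S j) s)%C).
  { exists p. apply Euler_sum_linear; [apply Euler_sum_linear|]; apply Hp; assumption. }
  destruct HE as [q HE].
  replace (eta_log x j (s + h) - eta_log x j s - h * - eta_log x (S j) s)%C
    with (eta_log x j (s + h) + (-1) * eta_log x j s + h * eta_log x (S j) s)%C by ring.
  assert (BW : forall m, Cmod (fdiff_iter n (fun i => (log_powers x j (s + h) i + (-1) * log_powers x j s i)
                        + h * log_powers x (S j) s i)%C m)
       <= 4 * B * Cmod h ^ 2 * telescopic_weight m).
  { intros m. eapply Rle_trans.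
    + apply fdiff_iter_remainder with (B := B * telescopic_weight m); auto.
      intros t Ht. apply HB, S2, Ht.
    + apply Req_le; ring. }
  destruct (ex_Euler_sum _ _ _ BW) as [l Hl].
  rewrite (Euler_sum_unique _ _ _ _ _ HE Hl).
  apply (Euler_sum_bound n _ _ _) with (3 := Hl); [|exact BW].
  intros i Hi. eapply Rle_trans.
  + apply fdiff_iter_remainder with (B := B); auto.
    intros t Ht. destruct (HB _ (S2 t Ht)) as [_ H]. now apply H.
  + apply Req_le; ring.
Qed.

Lemma C_lim_seq_log_powers_0 (x s : C) : 0 < Re x -> 0 < Re s ->
  C_lim_seq (log_powers x 0 s) (RtoC 0).
Proof.
  intros Hx Hs. destruct (Cmod_Cpower_shift x Hx) as [K [HK H]].
  apply C_lim_seq_dominated with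
    (fun m => exp (Cmod s * K) * exp (- Re s * ln (1 + INR m))).
  - intros m. replace (log_powers x 0 s m - 0)%C with (Cpower (RtoC (INR m) + x) (- s))
      by (unfold log_powers, log_power; simpl; ring).
    apply H; [apply Rle_refl | apply pos_INR].
  - replace (Finite 0) with (Rbar_mult (exp (Cmod s * K)) 0)
      by (simpl; f_equal; ring).
    apply is_lim_seq_scal_l.
    apply (is_lim_comp_seq exp (fun m => - Re s * ln (1 + INR m)) m_infty 0).
    + apply is_lim_exp_m.
    + exists O. intros; discriminate.
    + replace m_infty with (Rbar_mult (- Re s) p_infty).
      2:{ simpl. case Rle_dec; intros h; [exfalso; lra|reflexivity]. }
      apply is_lim_seq_scal_l.
      apply (is_lim_comp_seq ln (fun m => 1 + INR m) p_infty p_infty).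
      * apply is_lim_ln_p.
      * exists O. intros; discriminate.
      * apply is_lim_seq_plus with (l1 := Finite 1) (l2 := p_infty);
          auto using is_lim_seq_INR, is_lim_seq_const. reflexivity.
Qed.

Lemma zetaE_term_alternating (x s : C) (m : nat) :
  zetaE_term x s m = alternating (log_powers x 0 s) m.
Proof. unfold zetaE_term, alternating, log_powers, log_power. simpl. ring. Qed.

Lemma is_zetaE_eta_log (x : C) : 0 < Re x -> is_zetaE x (eta_log x 0).
Proof.
  intros Hx. split.
  - intros s. eexists. now apply is_derive_eta_log.
  - intros s Hs. destruct (eta_log_spec x (Cmod s) Hx) as [n Hn].
    apply C_is_series_ext with (alternating (log_powers x 0 s)).
    { intros m. symmetry; apply zetaE_term_alternating. }
    apply Euler_sum_regular with n.
    + now apply C_lim_seq_log_powers_0.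
    + apply Hn, Rle_refl.
Qed.

(** * Regularized products from a continuation *)

Lemma is_derive_C_approx (f : C -> C) (z l : C) (eps : R) :
  @is_derive C_AbsRing C_NormedModule f z l -> 0 < eps ->
  exists d, 0 < d /\
    forall h, Cmod h < d -> Cmod (f (z + h) - f z - h * l)%C <= eps * Cmod h.
Proof.
  intros [_ H] He.
  destruct (H z (fun P HP => HP) (mkposreal eps He)) as [d Hd].
  exists d. split; [apply cond_pos|]. intros h Hh.
  assert (Hb : Cmod ((z + h) - z) < d) by (replace (z + h - z)%C with h by ring; exact Hh).
  assert (K := Hd (z + h)%C Hb).
  change (Cmod ((f (z + h)%C - f z) - ((z + h) - z) * l)%C <= eps * Cmod ((z + h) - z)) in K.
  replace (z + h - z)%C with h in K by ring. exact K.
Qed.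

(** Derivatives at 0 are seen from the open right half-plane alone, since 0
    lies on its boundary. *)
Lemma derive_0_half_plane (f g : C -> C) (l m : C) :
  @is_derive C_AbsRing C_NormedModule f (RtoC 0) l ->
  @is_derive C_AbsRing C_NormedModule g (RtoC 0) m ->
  (forall s, 0 < Re s -> f s = g s) -> l = m.
Proof.
  intros Hf Hg E.
  assert (K : forall eps, 0 < eps -> exists d, 0 < d /\ forall t, 0 < t < d ->
     Cmod ((f (RtoC 0) - g (RtoC 0)) + RtoC t * (l - m))%C <= eps * t).
  { intros eps He.
    destruct (is_derive_C_approx f (RtoC 0) l (eps / 2) Hf ltac:(lra)) as [d1 [Hd1 H1]].
    destruct (is_derive_C_approx g (RtoC 0) m (eps / 2) Hg ltac:(lra)) as [d2 [Hd2 H2]].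
    exists (Rmin d1 d2). split; [now apply Rmin_pos|]. intros t [Ht1 Ht2].
    assert (T : Cmod (RtoC t) = t) by (rewrite Cmod_R, Rabs_pos_eq; lra).
    assert (G1 := H1 (RtoC t)). assert (G2 := H2 (RtoC t)). rewrite T in G1, G2.
    rewrite Cplus_0_l in G1, G2.
    assert (t < d1) by (eapply Rlt_le_trans; [exact Ht2 | apply Rmin_l]).
    assert (t < d2) by (eapply Rlt_le_trans; [exact Ht2 | apply Rmin_r]).
    specialize (G1 ltac:(assumption)). specialize (G2 ltac:(assumption)).
    rewrite (E (RtoC t) Ht1) in G1.
    replace (f (RtoC 0) - g (RtoC 0) + RtoC t * (l - m))%C
      with ((g (RtoC t) - g (RtoC 0) - RtoC t * m)
         - (g (RtoC t) - f (RtoC 0) - RtoC t * l))%C by ring.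
    eapply Rle_trans; [apply Cmod_minus_le|]. lra. }
  set (c := (f (RtoC 0) - g (RtoC 0))%C) in *. set (e := (l - m)%C) in *.
  assert (Hm := Cmod_ge_0 e).
  assert (Ec : c = RtoC 0).
  { apply Cmod_eq_0. apply Rle_antisym; [|apply Cmod_ge_0].
    apply le_epsilon. intros eps He. rewrite Rplus_0_l.
    destruct (K 1 Rlt_0_1) as [d [Hd H]].
    set (t := Rmin (d / 2) (eps / (1 + Cmod e))).
    assert (Hq : 0 < eps / (1 + Cmod e)) by (apply Rdiv_lt_0_compat; lra).
    assert (Ht : 0 < t) by (apply Rmin_pos; lra).
    assert (Htd : t <= d / 2) by apply Rmin_l.
    assert (Hte : t <= eps / (1 + Cmod e)) by apply Rmin_r.
    assert (G := H t ltac:(lra)).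
    assert (G2 := Cmod_minus_le (c + RtoC t * e) (RtoC t * e)).
    replace (c + RtoC t * e - RtoC t * e)%C with c in G2 by ring.
    rewrite (Cmod_mult (RtoC t)), Cmod_R, (Rabs_pos_eq t) in G2 by lra.
    assert (t * (1 + Cmod e) <= eps).
    { apply Rle_trans with (eps / (1 + Cmod e) * (1 + Cmod e)).
      - apply Rmult_le_compat_r; lra.
      - apply Req_le. field. lra. }
    nra. }
  assert (Ee : e = RtoC 0).
  { apply Cmod_eq_0. apply Rle_antisym; auto. apply le_epsilon. intros eps He.
    destruct (K eps He) as [d [Hd H]]. assert (G := H (d / 2) ltac:(lra)).
    rewrite Ec, Cplus_0_l, Cmod_mult, Cmod_R, Rabs_pos_eq in G by lra. nra. }
  unfold e in Ee. replace l with (l - m + m)%C by ring. rewrite Ee. ring.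
Qed.

Lemma path_connected_full : path_connected (fun _ => True).
Proof.
  intros z w _ _. exists (fun t => z + RtoC t * (w - z))%C.
  split; [|split; [ring|split; [ring|trivial]]].
  intros t.
  apply (ex_derive_continuous (K := R_AbsRing) (V := C_R_NormedModule)).
  exists (w - z)%C.
  split; [apply is_linear_scal_l|].
  intros y Hy.
  assert (E : y = t).
  { symmetry. apply (is_filter_lim_locally_unique (V := AbsRing_NormedModule R_AbsRing)). exact Hy. }
  subst y. intros eps. apply filter_forall. refine (fun (u : R) => _).
  replace (minus _ _) with (zero : C_R_NormedModule).
  - rewrite norm_zero. apply Rmult_le_pos; [left; apply cond_pos | apply norm_ge_0].
  - apply C_ext; unfold minus, plus, opp, scal; cbn; unfold plus, opp, mult; cbn; c_simpl; ring.
Qed.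

Lemma Cpower_0 (a : C) : Cpower a (RtoC 0) = RtoC 1.
Proof. unfold Cpower. rewrite Cmult_0_l. apply Cexp_0. Qed.

(** At [s = 0] all terms have modulus 1, so the series converges on no larger
    half-plane than [Re s > 0]. Every continuation therefore agrees with [Z]
    there, and [derive_0_half_plane] identifies its derivative at 0. *)
Lemma is_zreg_prod_intro (a : nat -> C) (eps : nat -> R) (Z : C -> C) (l P : C) :
  (forall n, a n <> RtoC 0 /\ (eps n = 1 \/ eps n = -1)) ->
  (forall s, C_ex_derive Z s) ->
  (forall s, 0 < Re s -> C_is_series (zreg_term a eps s) (Z s)) ->
  @is_derive C_AbsRing C_NormedModule Z (RtoC 0) l ->
  P = Cexp (- l) -> is_zreg_prod a eps P.
Proof.
  intros Ha HZ Hs Hl ->.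
  assert (Hconv : zreg_converges a eps 0) by (intros s h; exists (Z s); auto).
  assert (Habs : forall sigma, zreg_converges a eps sigma -> 0 <= sigma).
  { intros sigma H. destruct (Rle_lt_dec 0 sigma) as [|Hn]; auto. exfalso.
    destruct (H (RtoC 0) Hn) as [v Hv]. apply C_is_series_term_lim in Hv.
    apply C_lim_seq_Cmod in Hv. rewrite Cmod_0 in Hv.
    apply (is_lim_seq_ext _ (fun _ => 1)) in Hv.
    - apply is_lim_seq_unique in Hv. rewrite Lim_seq_const in Hv. injection Hv; lra.
    - intros n. unfold zreg_term. replace (- RtoC 0)%C with (RtoC 0) by ring.
      rewrite Cpower_0, Cmult_1_r, Cmod_R.
      destruct (Ha n) as [_ [-> | ->]]; [apply Rabs_R1 | rewrite Rabs_left; lra]. }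
  split; [exact Ha|split].
  - exists Z. split; [now exists 0|].
    exists (fun _ => True). split; [apply open_true|].
    split; [apply path_connected_full|]. split; [trivial|]. split; [auto|].
    intros sigma H s h. split; auto. apply Hs. generalize (Habs _ H). lra.
  - intros F [_ [U [_ [_ [U0 [HF HS]]]]]].
    destruct (HF _ U0) as [m Hm].
    rewrite (is_C_derive_unique F _ _ Hm). f_equal. f_equal.
    apply (derive_0_half_plane Z F); auto.
    intros s h. destruct (HS 0 Hconv s h) as [_ h2].
    exact (C_is_series_unique _ _ _ (Hs s h) h2).
Qed.

Lemma barGamma1_eta_log (x : C) : 0 < Re x ->
  barGamma1 x = Cexp (- eta_log x 1 (RtoC 0))%C.
Proof.
  intros Hx. assert (H := is_zetaE_eta_log x Hx).
  assert (Hz : is_zetaE x (fun s => zetaE s x)).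
  { apply (epsilon_spec (inhabits (fun _ : C => RtoC 0)) (is_zetaE x)). eauto. }
  unfold barGamma1. f_equal. destruct Hz as [H1 H2]. destruct (H1 (RtoC 0)) as [l Hl].
  rewrite (is_C_derive_unique _ _ _ Hl).
  apply (derive_0_half_plane _ _ _ _ Hl (is_derive_eta_log x 0 (RtoC 0) Hx)).
  intros s Hs. exact (C_is_series_unique _ _ _ (H2 s Hs) (proj2 H s Hs)).
Qed.

Lemma pow_m1_cases (n : nat) : (-1) ^ n = 1 \/ (-1) ^ n = -1.
Proof. induction n as [|n [IH|IH]]; simpl; rewrite ?IH; lra. Qed.

Lemma zreg_prod_barGamma1 (x : C) : 0 < Re x ->
  is_zreg_prod (fun n => RtoC (INR n) + x)%C (fun n => (-1) ^ (n + 1)) (barGamma1 x).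
Proof.
  intros Hx.
  assert (HD : forall s, @is_derive C_AbsRing C_NormedModule
     (fun u => - eta_log x 0 u)%C s (eta_log x 1 s)).
  { intros s. replace (eta_log x 1 s) with (- - eta_log x 1 s)%C by ring.
    apply (is_derive_opp (K := C_AbsRing) (V := C_NormedModule)). now apply is_derive_eta_log. }
  apply is_zreg_prod_intro with (fun u => - eta_log x 0 u)%C (eta_log x 1 (RtoC 0)).
  - intros n. split; [|apply pow_m1_cases].
    apply Re_pos_neq_0, Re_shift_pos; auto using pos_INR.
  - intros s. eexists. apply HD.
  - intros s Hs. generalize (proj2 (is_zetaE_eta_log x Hx) s Hs).
    rewrite !C_is_series_lim. intros H.
    apply C_lim_seq_ext with (fun n => (-1) * Csum (zetaE_term x s) n)%C.
    + induction n as [|n IH]; simpl; [ring|]. rewrite <- IH.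
      unfold zreg_term, zetaE_term. rewrite pow_add, RtoC_mult. simpl pow.
      rewrite RtoC_mult. ring.
    + replace (- eta_log x 0 s)%C with ((-1) * eta_log x 0 s)%C by ring.
      now apply C_lim_seq_scal.
  - apply HD.
  - now apply barGamma1_eta_log.
Qed.

Lemma zreg_prod_inv_barGamma1 (x : C) : 0 < Re x ->
  is_zreg_prod (fun n => RtoC (INR n) + x)%C (fun n => (-1) ^ n) (/ barGamma1 x)%C.
Proof.
  intros Hx.
  apply is_zreg_prod_intro with (eta_log x 0) (- eta_log x 1 (RtoC 0))%C.
  - intros n. split; [|apply pow_m1_cases].
    apply Re_pos_neq_0, Re_shift_pos; auto using pos_INR.
  - intros s. eexists. now apply is_derive_eta_log.
  - intros s Hs. exact (proj2 (is_zetaE_eta_log x Hx) s Hs).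
  - now apply is_derive_eta_log.
  - rewrite barGamma1_eta_log by assumption. now rewrite (Cexp_opp (- _)).
Qed.

(** * The regularized product as an ordinary limit *)

Lemma Cmod_pos_of_Re (z : C) : 0 < Re z -> 0 < Cmod z.
Proof. intros; now apply Cmod_gt_0, Re_pos_neq_0. Qed.

Lemma C_lim_seq_fdiff_Clog (x : C) : 0 < Re x ->
  C_lim_seq (fdiff (fun m => Clog (RtoC (INR m) + x))) (RtoC 0).
Proof.
  intros Hx.
  apply C_lim_seq_dominated with (fun m => 2 * / (INR m + Re x)).
  - intros m. assert (Pm := pos_INR m).
    replace (fdiff (fun m => Clog (RtoC (INR m) + x)) m - 0)%C
      with (fdiff (fun m => Clog (RtoC (INR m) + x)) m) by ring.
    unfold fdiff. rewrite Cmod_sub_sym, S_INR.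
    replace (2 * / (INR m + Re x)) with (2 * / (INR m + Re x) * (INR m + 1 - INR m)) by ring.
    apply (path_mean_value (fun u => Clog (RtoC u + x)) (fun u => / (RtoC u + x))%C); [lra| |].
    + intros t Ht. apply path_derive_Clog_shift. lra.
    + intros t Ht. assert (Hp := Re_shift_pos x t Hx ltac:(lra)).
      rewrite Cmod_inv by (now apply Re_pos_neq_0). apply Rinv_le_contravar; [lra|].
      apply Rle_trans with (Re (RtoC t + x)); [c_simpl; lra | apply Cmod_Re_pos; lra].
  - replace (Finite 0) with (Rbar_mult 2 0) by (simpl; f_equal; ring).
    apply is_lim_seq_scal_l.
    apply (is_lim_seq_inv (fun n => INR n + Re x) p_infty); [|discriminate].
    apply is_lim_seq_plus with (l1 := p_infty) (l2 := Finite (Re x));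
      auto using is_lim_seq_INR, is_lim_seq_const.
    reflexivity.
Qed.

Definition odd_even_ratio (x : C) (j : nat) : C :=
  ((RtoC (2 * INR j + 1) + x) / (RtoC (2 * INR j) + x))%C.

Lemma C_lim_seq_Clog_minus_ln (x : C) : 0 < Re x ->
  C_lim_seq (fun n => Clog (RtoC (INR n) + x) - RtoC (ln (INR n)))%C (RtoC 0).
Proof.
  intros Hx.
  assert (Hinv : is_lim_seq (fun n => / INR n) 0).
  { apply (is_lim_seq_inv INR p_infty); [apply is_lim_seq_INR | discriminate]. }
  apply C_lim_seq_components. split.
  - change (Re (RtoC 0)) with 0.
    apply is_lim_seq_le_le_loc with (u := fun _ => 0) (w := fun n => Cmod x * / INR n).
    + exists 1%nat. intros n Hn. assert (Pn : 0 < INR n) by (apply lt_0_INR; lia).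
      assert (Hp := Re_shift_pos x (INR n) Hx (Rlt_le _ _ Pn)).
      replace (Re (Clog (RtoC (INR n) + x) - RtoC (ln (INR n))))
        with (ln (Cmod (RtoC (INR n) + x)) - ln (INR n)) by (rewrite <- Clog_Re_ln; c_simpl; ring).
      split.
      * assert (ln (INR n) <= ln (Cmod (RtoC (INR n) + x))); [|lra].
        apply ln_le; auto. apply Rle_trans with (Re (RtoC (INR n) + x)); [c_simpl; lra|].
        apply Cmod_Re_pos; lra.
      * assert (ln (Cmod (RtoC (INR n) + x)) <= ln (INR n * exp (Cmod x * / INR n))).
        { apply ln_le; [now apply Cmod_pos_of_Re|].
          eapply Rle_trans; [apply Cmod_triangle|]. rewrite Cmod_R, Rabs_pos_eq by lra.
          apply Rle_trans with (INR n * (1 + Cmod x * / INR n)).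
          - apply Req_le; field; lra.
          - apply Rmult_le_compat_l; [lra|]. apply exp_ineq1_le. }
        rewrite ln_mult, ln_exp in H by (auto; apply exp_pos). lra.
    + apply is_lim_seq_const.
    + replace (Finite 0) with (Rbar_mult (Cmod x) 0) by (simpl; f_equal; ring).
      now apply is_lim_seq_scal_l.
  - apply is_lim_seq_ext with (fun n => atan (Im x / (INR n + Re x))).
    + intros n. assert (Hp := Re_shift_pos x (INR n) Hx (pos_INR n)).
      replace (Im (Clog (RtoC (INR n) + x) - RtoC (ln (INR n))))
        with (Im (Clog (RtoC (INR n) + x))) by (c_simpl; ring).
      rewrite Clog_atan by assumption. c_simpl. f_equal. f_equal. ring.
    + change (Im (RtoC 0)) with 0. rewrite <- atan_0.
      apply is_lim_seq_continuous.
      { apply derivable_continuous_pt, derivable_pt_atan. }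
      replace (Finite 0) with (Rbar_mult (Im x) 0) by (simpl; f_equal; ring).
      apply is_lim_seq_scal_l.
      apply (is_lim_seq_inv (fun n => INR n + Re x) p_infty); [|discriminate].
      apply is_lim_seq_plus with (l1 := p_infty) (l2 := Finite (Re x));
        auto using is_lim_seq_INR, is_lim_seq_const.
      reflexivity.
Qed.

Lemma filterlim_double : filterlim (fun n => (2 * n)%nat) eventually eventually.
Proof. intros P [N HN]. exists N. intros n Hn. apply HN. lia. Qed.

(** The differences of [Clog (m + x)] tend to 0, so its Euler sum is already
    reached by an ordinary series after one step. Its partial sums of even
    order are logarithms of the products, up to half of [Clog (2M + x)], which
    is [ln (2M)] in the limit. *)
Lemma barGamma1_limit (x : C) : 0 < Re x ->
  C_lim_seq (fun M => Cprod (odd_even_ratio x) M * RtoC (/ sqrt (2 * INR M)))%C (barGamma1 x).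
Proof.
  intros Hx. set (L := fun m => Clog (RtoC (INR m) + x)).
  set (l := eta_log x 1 (RtoC 0)).
  assert (HL : forall m, log_powers x 1 (RtoC 0) m = L m).
  { intros m. unfold log_powers, log_power. replace (- RtoC 0)%C with (RtoC 0) by ring.
    rewrite Cpower_0. unfold L. simpl. ring. }
  destruct (eta_log_spec x 0 Hx) as [n Hn].
  assert (Hl := Hn 1%nat (RtoC 0) (Req_le _ _ Cmod_0)). fold l in Hl.
  apply (Euler_sum_ext _ _ _ _ HL) in Hl. apply Euler_sum_step in Hl. simpl in Hl.
  apply Euler_sum_regular in Hl; [|now apply C_lim_seq_fdiff_Clog].
  apply C_is_series_lim in Hl.
  apply (C_lim_seq_subseq _ _ _ filterlim_double) in Hl.
  assert (H1 : C_lim_seq (fun M => - / 2 * (Csum (alternating (fdiff L)) (2 * M) + L O))%C (- l)%C).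
  { replace (- l)%C with (- / 2 * (2 * l - L O + L O))%C by field.
    apply C_lim_seq_scal. apply C_lim_seq_plus; auto using C_lim_seq_const. }
  assert (H2 := C_lim_seq_Clog_minus_ln x Hx).
  apply (C_lim_seq_subseq _ _ _ filterlim_double) in H2.
  (* adding half of the null sequence H2 trades Clog (2M + x) for ln (2M) *)
  assert (H3 := C_lim_seq_plus _ _ _ _ H1 (C_lim_seq_scal (/ 2) _ _ H2)).
  apply C_lim_seq_Cexp in H3.
  replace (- l + / 2 * RtoC 0)%C with (- l)%C in H3 by ring.
  rewrite barGamma1_eta_log by assumption. fold l.
  revert H3. apply C_lim_seq_ext_loc. exists 1%nat. intros M HM.
  assert (PM : 0 < INR M) by (apply lt_0_INR; lia).
  assert (E : Cexp (- Csum (alternating L) (2 * M)) = Cprod (odd_even_ratio x) M).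
  { clear -Hx. induction M as [|M IH].
    - simpl. replace (- RtoC 0)%C with (RtoC 0) by ring. apply Cexp_0.
    - replace (2 * S M)%nat with (S (S (2 * M))) by lia.
      simpl Cprod. rewrite <- IH. cbn [Csum].
      replace (- (Csum (alternating L) (2 * M) + alternating L (2 * M) + alternating L (S (2 * M))))%C
        with (- Csum (alternating L) (2 * M) + (L (S (2 * M)) - L (2 * M)%nat))%C.
      + rewrite Cexp_plus, Cexp_minus. unfold odd_even_ratio, L.
        rewrite !Cexp_Clog by (apply Re_shift_pos; auto using pos_INR).
        rewrite S_INR, mult_INR. simpl (INR 2). reflexivity.
      + unfold alternating. rewrite <- tech_pow_Rmult, pow_1_even, RtoC_mult. ring. }
  rewrite <- E. rewrite Csum_alternating_fdiff.
  assert (A : alternating L (2 * M) = L (2 * M)%nat)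
    by (unfold alternating; rewrite pow_1_even; ring).
  rewrite A. change (Clog (RtoC (INR (2 * M)) + x)) with (L (2 * M)%nat).
  match goal with |- Cexp ?u = _ =>
    replace u with (- Csum (alternating L) (2 * M) + - (/ 2 * RtoC (ln (INR (2 * M)))))%C by field
  end.
  rewrite Cexp_plus. apply (f_equal (Cmult _)).
  replace (- (/ 2 * RtoC (ln (INR (2 * M)))))%C with (RtoC (- (/ 2 * ln (INR (2 * M))))).
  - rewrite Cexp_RtoC. f_equal. rewrite exp_Ropp. f_equal.
    rewrite mult_INR. simpl (INR 2).
    rewrite <- Rpower_sqrt by lra. reflexivity.
  - rewrite RtoC_opp, RtoC_mult, RtoC_inv by lra. reflexivity.
Qed.

(** * Improper integrals through antiderivatives *)

Definition path_continuous (f : R -> C) (t : R) : Prop :=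
  continuous (fun u => Re (f u)) t /\ continuous (fun u => Im (f u)) t.

Lemma path_derive_continuous (f : R -> C) (t : R) (l : C) :
  is_path_derive f t l -> path_continuous f t.
Proof.
  intros [H1 H2]; split; apply (ex_derive_continuous (V := R_NormedModule));
    eexists; eassumption.
Qed.

Lemma ex_path_antiderivative (f : R -> C) :
  (forall t, 0 < t -> path_continuous f t) ->
  exists F, forall t, 0 < t -> is_path_derive F t (f t).
Proof.
  intros H.
  assert (K : forall g : R -> R, (forall t, 0 < t -> continuous g t) ->
    forall t, 0 < t -> is_derive (fun b => RInt g 1 b) t (g t)).
  { intros g Hg t Ht. apply (is_derive_RInt (V := R_NormedModule) g _ 1 t); auto.
    exists (mkposreal t Ht). intros b Hb. apply (RInt_correct (V := R_CompleteNormedModule)).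
    assert (Hb0 : 0 < b).
    { assert (Hb' : Rabs (b - t) < t) by exact Hb. apply Rabs_lt_between in Hb'. lra. }
    apply ex_RInt_continuous. intros z [Hz _]. apply Hg.
    eapply Rlt_le_trans; [|exact Hz]. apply Rmin_pos; lra. }
  exists (fun b => (RInt (fun u => Re (f u)) 1 b, RInt (fun u => Im (f u)) 1 b)).
  intros t Ht. split.
  - apply (K (fun u => Re (f u))); auto. intros; now apply H.
  - apply (K (fun u => Im (f u))); auto. intros; now apply H.
Qed.

Lemma is_RInt_path (F f : R -> C) (a b : R) :
  a <= b ->
  (forall t, a <= t <= b -> is_path_derive F t (f t) /\ path_continuous f t) ->
  @is_RInt C_R_NormedModule f a b (F b - F a)%C.
Proof.
  intros Hab H.
  apply (is_RInt_fct_extend_pair (U := R_NormedModule) (V := R_NormedModule) f a b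
    (Re (F b - F a)) (Im (F b - F a))).
  - apply (is_RInt_derive (V := R_CompleteNormedModule) (fun u => Re (F u)) (fun u => Re (f u)));
      rewrite Rmin_left, Rmax_right by assumption; intros t Ht; apply H, Ht.
  - apply (is_RInt_derive (V := R_CompleteNormedModule) (fun u => Im (F u)) (fun u => Im (f u)));
      rewrite Rmin_left, Rmax_right by assumption; intros t Ht; apply H, Ht.
Qed.

Lemma is_lim_seq_0_eventually (v : nat -> R) (eps : R) :
  is_lim_seq v 0 -> 0 < eps -> exists N, forall n, (N <= n)%nat -> v n < eps.
Proof.
  intros H He. destruct (H (fun y => y < eps)) as [N HN].
  - exists (mkposreal eps He). intros y Hy.
    assert (Hy' : Rabs (y - 0) < eps) by exact Hy.
    generalize (Rle_abs (y - 0)). lra.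
  - now exists N.
Qed.

Lemma C_lim_seq_Cmod_le_loc (u : nat -> C) (l : C) (B : R) :
  C_lim_seq u l -> (exists N, forall n, (N <= n)%nat -> Cmod (u n) <= B) -> Cmod l <= B.
Proof.
  intros H HB.
  apply (is_lim_seq_le_loc (fun n => Cmod (u n)) (fun _ => B) (Cmod l) B HB).
  - now apply C_lim_seq_Cmod.
  - apply is_lim_seq_const.
Qed.

Lemma C_lim_seq_cauchy (u : nat -> C) (v : nat -> R) :
  is_lim_seq v 0 -> (forall n m, (n <= m)%nat -> Cmod (u m - u n) <= v n) ->
  exists L, C_lim_seq u L.
Proof.
  intros Hv H.
  assert (K : forall p : C -> R, (forall z w, Rabs (p z - p w) <= Cmod (z - w)) ->
     ex_finite_lim_seq (fun n => p (u n))).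
  { intros p Hp. apply ex_lim_seq_cauchy_corr. intros eps.
    destruct (is_lim_seq_0_eventually v eps Hv (cond_pos eps)) as [N HN].
    exists N. intros n m Hn Hm. destruct (Nat.le_ge_cases n m) as [h|h].
    - rewrite Rabs_minus_sym. eapply Rle_lt_trans; [apply Hp|].
      eapply Rle_lt_trans; [apply H, h | apply HN, Hn].
    - eapply Rle_lt_trans; [apply Hp|].
      eapply Rle_lt_trans; [apply H, h | apply HN, Hm]. }
  destruct (K Re) as [a Ha].
  { intros z w. apply (re_le_Cmod (z - w)). }
  destruct (K Im) as [b Hb].
  { intros z w. apply (Im_le_Cmod (z - w)). }
  exists (a, b). apply C_lim_seq_components. now split.
Qed.

Lemma is_lim_seq_inv_S : is_lim_seq (fun n => / (INR n + 1)) 0.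
Proof.
  apply (is_lim_seq_inv (fun n => INR n + 1) p_infty); [|discriminate].
  apply is_lim_seq_plus with (l1 := p_infty) (l2 := Finite 1);
    auto using is_lim_seq_INR, is_lim_seq_const.
  reflexivity.
Qed.

Lemma is_lim_seq_scal_0 (c : R) (v : nat -> R) :
  is_lim_seq v 0 -> is_lim_seq (fun n => c * v n) 0.
Proof.
  intros H. replace (Finite 0) with (Rbar_mult c 0) by (simpl; f_equal; ring).
  now apply is_lim_seq_scal_l.
Qed.

Lemma path_limit_at_0 (F : R -> C) (H : R -> R) :
  (forall a b, 0 < a <= b -> b <= 1 -> Cmod (F b - F a) <= H b) ->
  is_lim_seq (fun n => H (/ (INR n + 1))) 0 ->
  exists L, forall b, 0 < b <= 1 -> Cmod (F b - L) <= H b.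
Proof.
  intros HF HH. set (w := fun n => / (INR n + 1)) in *.
  assert (Hw : forall n, 0 < w n <= 1).
  { intros n. assert (P := pos_INR n). unfold w. split; [apply Rinv_0_lt_compat; lra|].
    rewrite <- Rinv_1 at 2. apply Rinv_le_contravar; lra. }
  destruct (C_lim_seq_cauchy (fun n => F (w n)) _ HH) as [L HL].
  { intros n m Hnm. rewrite Cmod_sub_sym. apply HF; [split; [apply Hw|] | apply Hw].
    unfold w. assert (P := pos_INR n). apply le_INR in Hnm. apply Rinv_le_contravar; lra. }
  exists L. intros b Hb.
  apply (C_lim_seq_Cmod_le_loc (fun n => F b - F (w n))%C).
  - apply C_lim_seq_minus; auto using C_lim_seq_const.
  - destruct (is_lim_seq_0_eventually w b is_lim_seq_inv_S (proj1 Hb)) as [N HN].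
    exists N. intros n Hn. apply HF; [|apply Hb]. split; [apply Hw | left; now apply HN].
Qed.

Lemma path_limit_at_infty (F : R -> C) (H : R -> R) :
  (forall a b, 1 <= a <= b -> Cmod (F b - F a) <= H a) ->
  is_lim_seq (fun n => H (INR n + 1)) 0 ->
  exists L, forall a, 1 <= a -> Cmod (F a - L) <= H a.
Proof.
  intros HF HH.
  destruct (C_lim_seq_cauchy (fun n => F (INR n + 1)) _ HH) as [L HL].
  { intros n m Hnm. apply HF. assert (P := pos_INR n). apply le_INR in Hnm. lra. }
  exists L. intros a Ha.
  apply (C_lim_seq_Cmod_le_loc (fun n => F a - F (INR n + 1)%R)%C).
  - apply C_lim_seq_minus; auto using C_lim_seq_const.
  - destruct (INR_archimed 1 a) as [N HN]; [lra|]. rewrite Rmult_1_r in HN.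
    exists N. intros n Hn. rewrite Cmod_sub_sym. apply HF. apply le_INR in Hn. lra.
Qed.

(** [H0] and [H1] are rates of convergence of the antiderivative at the two
    ends of the half-line. *)
Lemma is_RInt_gen_antiderivative (F f : R -> C) (L0 L1 : C) (H0 H1 : R -> R) (g : R -> C):
  (forall t, 0 < t -> is_path_derive F t (f t) /\ path_continuous f t) ->
  (forall t, 0 < t -> f t = g t) ->
  (forall b, 0 < b <= 1 -> Cmod (F b - L0) <= H0 b) ->
  (forall b, 1 <= b -> Cmod (F b - L1) <= H1 b) ->
  filterlim H0 (at_right 0) (locally 0) ->
  filterlim H1 (Rbar_locally p_infty) (locally 0) ->
  @is_RInt_gen C_R_NormedModule g (at_right 0) (Rbar_locally p_infty) (L1 - L0)%C.
Proof.
  intros HF Hfg HL0 HL1 l0 l1 P [eps HP].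
  assert (He : 0 < eps / 2) by (generalize (cond_pos eps); lra).
  assert (B0 : at_right 0 (fun a => (0 < a <= 1) /\ H0 a < eps / 2)).
  { apply filter_and.
    - exists (mkposreal 1 Rlt_0_1). intros y Hy Hy0.
      assert (Hy' : Rabs (y - 0) < 1) by exact Hy.
      apply Rabs_lt_between in Hy'. lra.
    - apply (l0 (fun v => v < eps / 2)). apply open_lt. exact He. }
  assert (B1 : Rbar_locally p_infty (fun b => 1 <= b /\ H1 b < eps / 2)).
  { apply filter_and.
    - exists 1. intros; lra.
    - apply (l1 (fun v => v < eps / 2)). apply open_lt. exact He. }
  unfold filtermapi.
  apply (Filter_prod _ _ _ _ _ B0 B1).
  intros a b [[Ha1 Ha2] Ha3] [Hb1 Hb2]. simpl fst; simpl snd.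
  exists (F b - F a)%C. split.
  - apply (is_RInt_ext (V := C_R_NormedModule) f).
    + rewrite Rmin_left, Rmax_right by lra. intros t Ht. apply Hfg; lra.
    + apply is_RInt_path; [lra|]. intros t Ht. apply HF. lra.
  - apply HP.
    assert (K : Cmod ((F b - F a) - (L1 - L0))%C < eps).
    { replace ((F b - F a) - (L1 - L0))%C with ((F b - L1) - (F a - L0))%C by ring.
      eapply Rle_lt_trans; [apply Cmod_minus_le|].
      assert (X := HL1 b Hb1). assert (Y := HL0 a (conj Ha1 Ha2)). lra. }
    split.
    + eapply Rle_lt_trans; [apply (re_le_Cmod ((F b - F a) - (L1 - L0))%C)|exact K].
    + eapply Rle_lt_trans; [apply (Im_le_Cmod ((F b - F a) - (L1 - L0))%C)|exact K].
Qed.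

(** * Euler's integral as the limit of Gauss's products *)

Definition rpower (w : C) (t : R) : C := Cexp (w * RtoC (ln t)).

Lemma Cpower_RtoC (t : R) (w : C) : 0 < t -> Cpower (RtoC t) w = rpower w t.
Proof. intros H. unfold Cpower, rpower. now rewrite Clog_RtoC. Qed.

Lemma Cmod_rpower (w : C) (t : R) : Cmod (rpower w t) = exp (Re w * ln t).
Proof. unfold rpower. rewrite Cmod_Cexp. f_equal. c_simpl. ring. Qed.

Lemma rpower_1 (w : C) : rpower w 1 = RtoC 1.
Proof. unfold rpower. rewrite ln_1, Cmult_0_r. apply Cexp_0. Qed.

Lemma rpower_plus (v w : C) (t : R) : rpower (v + w) t = (rpower v t * rpower w t)%C.
Proof. unfold rpower. rewrite <- Cexp_plus. f_equal. ring. Qed.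

Lemma rpower_mult (w : C) (t u : R) : 0 < t -> 0 < u ->
  rpower w (t * u) = (rpower w t * rpower w u)%C.
Proof.
  intros Ht Hu. unfold rpower. rewrite <- Cexp_plus, ln_mult, RtoC_plus by assumption.
  f_equal. ring.
Qed.

Lemma rpower_one (t : R) : 0 < t -> rpower 1 t = RtoC t.
Proof. intros H. unfold rpower. rewrite Cmult_1_l, Cexp_RtoC, exp_ln; auto. Qed.

Lemma rpower_minus_one (w : C) (t : R) : 0 < t -> rpower w t = (rpower (w - 1) t * RtoC t)%C.
Proof.
  intros H. rewrite <- (rpower_one t) by assumption. rewrite <- rpower_plus.
  f_equal. ring.
Qed.

Lemma path_derive_rpower (w : C) (t : R) : 0 < t ->
  is_path_derive (rpower w) t (w * rpower (w - 1) t)%C.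
Proof.
  intros Ht. eapply path_derive_eq.
  - apply path_derive_Cexp. apply path_derive_scal. apply path_derive_RtoC.
    apply is_derive_ln, Ht.
  - cbv beta. change (Cexp (w * RtoC (ln t))%C) with (rpower w t).
    rewrite (rpower_minus_one w t Ht), RtoC_inv by lra.
    field. intros E; apply RtoC_inj in E; lra.
Qed.

(** An antiderivative of [t^(z-1) (1-t)^n], from repeated integration by
    parts. *)
Fixpoint beta_primitive (n : nat) (z : C) (t : R) : C :=
  match n with
  | O => (rpower z t / z)%C
  | S k => ((rpower z t * RtoC ((1 - t) ^ S k)
             + RtoC (INR (S k)) * beta_primitive k (z + 1) t) / z)%C
  end.

Lemma Re_succ_pos (z : C) : 0 < Re z -> 0 < Re (z + 1).
Proof. intros; c_simpl; lra. Qed.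

Lemma path_derive_beta_primitive (n : nat) (z : C) (t : R) : 0 < Re z -> 0 < t ->
  is_path_derive (beta_primitive n z) t (rpower (z - 1) t * RtoC ((1 - t) ^ n))%C.
Proof.
  revert z. induction n as [|n IH]; intros z Hz Ht; assert (Z0 := Re_pos_neq_0 z Hz).
  - apply path_derive_ext with (fun u => / z * rpower z u)%C.
    { intros u. simpl. unfold Cdiv. ring. }
    eapply path_derive_eq; [apply path_derive_scal; now apply path_derive_rpower|].
    simpl. field. exact Z0.
  - apply path_derive_ext with (fun u => / z * (rpower z u * RtoC ((1 - u) ^ S n)
             + RtoC (INR (S n)) * beta_primitive n (z + 1) u))%C.
    { intros u. cbn [beta_primitive]. unfold Cdiv. ring. }
    eapply path_derive_eq.
    + apply path_derive_scal. apply path_derive_plus.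
      * apply path_derive_mult; [now apply path_derive_rpower|].
        apply path_derive_RtoC with (l := - INR (S n) * (1 - t) ^ n).
        auto_derive; auto.
        change (match n with O => 1 | S _ => INR n + 1 end) with (INR (S n)). unfold Rminus. ring.
      * apply path_derive_scal. apply IH; auto using Re_succ_pos.
    + cbv beta. replace (z + 1 - 1)%C with z by ring.
      rewrite RtoC_mult, RtoC_opp. field. exact Z0.
Qed.

Lemma beta_primitive_bound (n : nat) (z : C) : 0 < Re z ->
  exists K, forall t, 0 < t <= 1 -> Cmod (beta_primitive n z t) <= K * exp (Re z * ln t).
Proof.
  revert z. induction n as [|n IH]; intros z Hz; assert (Z0 := Re_pos_neq_0 z Hz).
  - exists (/ Cmod z). intros t Ht. simpl. rewrite Cmod_div, Cmod_rpower by assumption.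
    apply Req_le. unfold Rdiv. ring.
  - destruct (IH (z + 1)%C (Re_succ_pos z Hz)) as [K HK].
    exists ((1 + INR (S n) * Rabs K) / Cmod z). intros t Ht.
    assert (Hm := Cmod_pos_of_Re z Hz).
    cbn [beta_primitive]. rewrite Cmod_div by assumption.
    unfold Rdiv. rewrite Rmult_assoc, (Rmult_comm (/ _)), <- Rmult_assoc.
    apply Rmult_le_compat_r; [left; now apply Rinv_0_lt_compat|].
    eapply Rle_trans; [apply Cmod_triangle|].
    rewrite !Cmod_mult, !Cmod_R, Cmod_rpower, Rmult_plus_distr_r.
    assert (Pn := pos_INR (S n)).
    assert (Hl : ln t <= 0) by (rewrite <- ln_1; apply ln_le; lra).
    apply Rplus_le_compat.
    + rewrite Rmult_comm. apply Rmult_le_compat_r; [left; apply exp_pos|].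
      rewrite <- RPow_abs, Rabs_pos_eq by lra.
      apply Rle_trans with (1 ^ S n); [apply pow_incr; lra | rewrite pow1; lra].
    + rewrite Rabs_pos_eq, !Rmult_assoc by assumption. apply Rmult_le_compat_l; auto.
      eapply Rle_trans; [apply HK, Ht|].
      apply Rle_trans with (Rabs K * exp (Re (z + 1) * ln t)).
      * apply Rmult_le_compat_r; [left; apply exp_pos | apply Rle_abs].
      * apply Rmult_le_compat_l; [apply Rabs_pos|]. apply exp_le. c_simpl. nra.
Qed.

Lemma Cprod_shift (u : nat -> C) (n : nat) :
  Cprod u (S n) = (u O * Cprod (fun j => u (S j)) n)%C.
Proof.
  induction n as [|n IH]; [simpl; ring|].
  change (Cprod u (S (S n))) with (Cprod u (S n) * u (S n))%C. rewrite IH. simpl. ring.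
Qed.

Lemma Cprod_ext (u v : nat -> C) (n : nat) :
  (forall j, (j < n)%nat -> u j = v j) -> Cprod u n = Cprod v n.
Proof.
  intros H. induction n as [|n IH]; [reflexivity|]. simpl.
  rewrite IH, H by (auto; intros; apply H; lia). reflexivity.
Qed.

Lemma Cprod_neq_0 (u : nat -> C) (n : nat) :
  (forall j, u j <> RtoC 0) -> Cprod u n <> RtoC 0.
Proof.
  intros H. induction n as [|n IH]; simpl; [apply C1_nz | apply Cmult_neq_0; auto].
Qed.

Definition rising (z : C) (n : nat) : C := Cprod (fun j => z + RtoC (INR j))%C (S n).

Lemma rising_S (z : C) (n : nat) : rising z (S n) = (z * rising (z + 1) n)%C.
Proof.
  unfold rising. rewrite Cprod_shift. f_equal; [simpl; ring|].
  apply Cprod_ext. intros j _. rewrite S_INR, RtoC_plus. ring.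
Qed.

Lemma Re_add_INR_pos (z : C) (j : nat) : 0 < Re z -> 0 < Re (z + RtoC (INR j)).
Proof. intros; assert (P := pos_INR j); c_simpl; lra. Qed.

Lemma rising_neq_0 (z : C) (n : nat) : 0 < Re z -> rising z n <> RtoC 0.
Proof. intros H. apply Cprod_neq_0. intros j. now apply Re_pos_neq_0, Re_add_INR_pos. Qed.

Lemma beta_primitive_1 (n : nat) (z : C) : 0 < Re z ->
  beta_primitive n z 1 = (RtoC (INR (fact n)) / rising z n)%C.
Proof.
  revert z. induction n as [|n IH]; intros z Hz; assert (Z0 := Re_pos_neq_0 z Hz).
  - simpl. rewrite rpower_1. unfold rising; simpl. field.
    replace (z + 0)%C with z by ring. exact Z0.
  - cbn [beta_primitive]. rewrite rpower_1, Rminus_diag, IH by auto using Re_succ_pos.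
    rewrite rising_S, pow_i by lia. rewrite fact_simpl, mult_INR, RtoC_mult.
    field. split; auto. apply rising_neq_0; auto using Re_succ_pos.
Qed.

Definition gauss_product (n : nat) (z : C) : C :=
  (rpower z (INR n) * (RtoC (INR (fact n)) / rising z n))%C.

(** With [q = t / n]: the lower bound is [1 - q <= exp (- q)], and the upper one
    comes from [(1 - q)^n (1 + q)^n = (1 - q^2)^n >= 1 - n q^2] and
    [1 + q <= exp q]. *)
Lemma exp_minus_pow_bounds (n : nat) (t : R) : (0 < n)%nat -> 0 <= t <= INR n ->
  0 <= exp (- t) - (1 - t / INR n) ^ n <= t ^ 2 * exp (- t) / INR n.
Proof.
  intros Hn Ht. assert (Pn : 0 < INR n) by now apply lt_0_INR.
  set (q := t / INR n).
  assert (Hq : 0 <= q <= 1).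
  { unfold q. split; [apply Rdiv_le_0_compat; lra|].
    apply Rmult_le_reg_r with (INR n); auto. unfold Rdiv. rewrite Rmult_assoc, Rinv_l; lra. }
  assert (E : t = INR n * q) by (unfold q; field; lra).
  assert (H1 : (1 - q) ^ n <= exp (- t)).
  { rewrite E, Ropp_mult_distr_r, exp_mult_INR. apply pow_incr. split; [lra|].
    generalize (exp_ineq1_le (- q)). lra. }
  split; [lra|].
  assert (H2 : (1 + q) ^ n <= exp t).
  { rewrite E, exp_mult_INR. apply pow_incr. split; [lra|]. apply exp_ineq1_le. }
  assert (H3 : 1 - INR n * q ^ 2 <= (1 - q) ^ n * exp t).
  { apply Rle_trans with ((1 - q) ^ n * (1 + q) ^ n).
    - rewrite <- Rpow_mult_distr. replace ((1 - q) * (1 + q)) with (1 - q ^ 2) by ring.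
      assert (G : forall v k, 0 <= v <= 1 -> 1 - INR k * v <= (1 - v) ^ k).
      { clear. intros v k Hv. induction k as [|k IH]; [simpl; lra|].
        rewrite S_INR. simpl. assert (0 <= (1 - v) ^ k <= 1).
        { split; [apply pow_le; lra|].
          apply Rle_trans with (1 ^ k); [apply pow_incr; lra | rewrite pow1; lra]. }
        nra. }
      apply G. nra.
    - apply Rmult_le_compat_l; auto. apply pow_le; lra. }
  assert (H4 : exp t * exp (- t) = 1) by (rewrite <- exp_plus, Rplus_opp_r; apply exp_0).
  assert (H5 := exp_pos (- t)).
  replace (t ^ 2 * exp (- t) / INR n) with (INR n * q ^ 2 * exp (- t)) by (rewrite E; field; lra).
  assert (H6 : (1 - INR n * q ^ 2) * exp (- t) <= (1 - q) ^ n * exp t * exp (- t))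
    by (apply Rmult_le_compat_r; lra).
  rewrite Rmult_assoc, H4, Rmult_1_r in H6. fold q. lra.
Qed.

(** The exponent [p ln t - t] is largest at [t = p]. *)
Lemma power_exp_bounded (p : R) : 0 < p ->
  exists K, forall t, 0 < t -> exp (p * ln t) * exp (- t) <= K.
Proof.
  intros Hp. exists (exp (p * ln p - p)). intros t Ht. rewrite <- exp_plus. apply exp_le.
  assert (H : ln (t / p) <= t / p - 1).
  { generalize (exp_ineq1_le (ln (t / p))). rewrite exp_ln by (now apply Rdiv_lt_0_compat). lra. }
  rewrite ln_div in H by assumption.
  assert (p * (ln t - ln p) <= p * (t / p - 1)) by (apply Rmult_le_compat_l; lra).
  replace (p * (t / p - 1)) with (t - p) in * by (field; lra). lra.
Qed.

Lemma power_exp_decay (p : R) : 0 < p ->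
  exists K, 0 <= K /\ forall t, 0 < t -> exp (p * ln t) * exp (- t) <= K / (1 + t) ^ 2.
Proof.
  intros Hp.
  destruct (power_exp_bounded p Hp) as [K0 H0].
  destruct (power_exp_bounded (p + 1) ltac:(lra)) as [K1 H1].
  destruct (power_exp_bounded (p + 2) ltac:(lra)) as [K2 H2].
  assert (B : forall t, 0 < t -> exp (p * ln t) * exp (- t) * (1 + t) ^ 2 <= K0 + 2 * K1 + K2).
  { intros t Ht. specialize (H0 t Ht). specialize (H1 t Ht). specialize (H2 t Ht).
    rewrite !Rmult_plus_distr_r, !exp_plus, Rmult_1_l in *.
    replace (exp (2 * ln t)) with (t * t) in H2.
    - rewrite exp_ln in H1 by assumption. nra.
    - replace (2 * ln t) with (ln t + ln t) by ring. rewrite exp_plus, exp_ln; auto. }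
  exists (K0 + 2 * K1 + K2). split.
  - eapply Rle_trans; [|apply (B 1 Rlt_0_1)].
    repeat apply Rmult_le_pos; try (left; apply exp_pos); lra.
  - intros t Ht. apply Rmult_le_reg_r with ((1 + t) ^ 2); [nra|].
    replace ((K0 + 2 * K1 + K2) / (1 + t) ^ 2 * (1 + t) ^ 2) with (K0 + 2 * K1 + K2)
      by (field; nra).
    now apply B.
Qed.

Lemma filterlim_scal_power_0 (c p : R) : 0 < p ->
  filterlim (fun t => c * exp (p * ln t)) (at_right 0) (locally 0).
Proof.
  intros Hp. replace 0 with (c * 0) at 2 by ring.
  apply (filterlim_comp _ _ _ (fun t => exp (p * ln t)) (fun v => c * v) _ (locally 0)).
  - apply (filterlim_comp _ _ _ (fun t => p * ln t) exp _ (Rbar_locally m_infty)).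
    + apply (filterlim_comp _ _ _ ln (fun y => p * y) _ (Rbar_locally m_infty)).
      * apply is_lim_ln_0.
      * intros P [M HM]. exists (M / p). intros y Hy. apply HM.
        replace M with (p * (M / p)) by (field; lra). now apply Rmult_lt_compat_l.
    + exact is_lim_exp_m.
  - apply (continuous_scal_r (V := R_NormedModule) c (fun v => v) 0).
    apply continuous_id.
Qed.

Lemma is_lim_scal_inv_infty (K : R) : is_lim (fun b => 2 * (K / (1 + b))) p_infty 0.
Proof.
  replace (Finite 0) with (Rbar_mult 2 (Rbar_mult K 0)) by (simpl; f_equal; ring).
  apply is_lim_scal_l. apply is_lim_scal_l.
  replace (Finite 0) with (Rbar_inv p_infty) by reflexivity.
  apply is_lim_inv; [|discriminate].
  apply is_lim_plus with (lf := Finite 1) (lg := p_infty).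
  - apply is_lim_const.
  - apply is_lim_id.
  - reflexivity.
Qed.

Lemma is_derive_opp_inv_shift (c t : R) : 0 < t ->
  is_derive (fun u => - (c / (1 + u))) t (c / (1 + t) ^ 2).
Proof. intros Ht. auto_derive; [lra|]. field. lra. Qed.

Definition euler_integrand (z : C) (t : R) : C :=
  (rpower (z - 1) t * RtoC (exp (- t)))%C.

Lemma path_continuous_euler_integrand (z : C) (t : R) : 0 < t ->
  path_continuous (euler_integrand z) t.
Proof.
  intros Ht. eapply path_derive_continuous. apply path_derive_mult.
  - now apply path_derive_rpower.
  - apply path_derive_RtoC with (l := - exp (- t)). auto_derive; auto. ring.
Qed.

Lemma Cmod_euler_integrand (z : C) (t : R) :
  Cmod (euler_integrand z t) = exp ((Re z - 1) * ln t) * exp (- t).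
Proof.
  unfold euler_integrand. rewrite Cmod_mult, Cmod_rpower, Cmod_R.
  rewrite Rabs_pos_eq by (left; apply exp_pos). reflexivity.
Qed.

Lemma euler_integrand_decay (z : C) : 0 < Re z ->
  exists K, 0 <= K /\
    forall t, 0 < t -> Cmod (euler_integrand z t) * t ^ 2 <= K / (1 + t) ^ 2.
Proof.
  intros Hz. destruct (power_exp_decay (Re z + 1) ltac:(lra)) as [K [HK H]].
  exists K. split; auto. intros t Ht. specialize (H t Ht).
  replace ((Re z + 1) * ln t) with ((Re z - 1) * ln t + (ln t + ln t)) in H by ring.
  rewrite !exp_plus, exp_ln in H by assumption.
  rewrite Cmod_euler_integrand. nra.
Qed.

Lemma euler_primitive_at_0 (z : C) (F : R -> C) : 0 < Re z ->
  (forall t, 0 < t -> is_path_derive F t (euler_integrand z t)) ->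
  exists L, forall b, 0 < b <= 1 -> Cmod (F b - L) <= 2 / Re z * exp (Re z * ln b).
Proof.
  intros Hz HF. set (p := Re z) in *.
  apply (path_limit_at_0 F (fun b => 2 / p * exp (p * ln b))).
  - intros a b Ha Hb.
    apply Rle_trans with (2 * (exp (p * ln b) / p - exp (p * ln a) / p)).
    + apply (path_increment_le F (euler_integrand z)
        (fun t => exp (p * ln t) / p) (fun t => exp ((p - 1) * ln t))); [lra| | |].
      * intros t Ht. apply HF; lra.
      * intros t Ht. auto_derive; [lra|].
        replace ((p - 1) * ln t) with (p * ln t + - ln t) by ring.
        rewrite exp_plus, exp_Ropp, exp_ln by lra. field. lra.
      * intros t Ht. rewrite Cmod_euler_integrand. fold p.
        rewrite <- (Rmult_1_r (exp ((p - 1) * ln t))) at 2.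
        apply Rmult_le_compat_l; [left; apply exp_pos|].
        rewrite <- exp_0. apply exp_le. lra.
    + assert (X := exp_pos (p * ln a)).
      assert (0 < exp (p * ln a) / p) by (apply Rdiv_lt_0_compat; lra).
      replace (2 / p * exp (p * ln b)) with (2 * (exp (p * ln b) / p)) by (field; lra).
      lra.
  - apply (filterlim_comp _ _ _ (fun n => / (INR n + 1))
      (fun b => 2 / p * exp (p * ln b)) _ (at_right 0)); [|now apply filterlim_scal_power_0].
    intros P [d Hd].
    destruct (is_lim_seq_0_eventually _ d is_lim_seq_inv_S (cond_pos d)) as [N HN].
    exists N. intros n Hn. assert (Pn := pos_INR n).
    assert (0 < / (INR n + 1)) by (apply Rinv_0_lt_compat; lra).
    apply Hd; auto. change (Rabs (/ (INR n + 1) - 0) < d).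
    rewrite Rminus_0_r, Rabs_pos_eq by lra. now apply HN.
Qed.

Lemma euler_primitive_at_infty (z : C) (F : R -> C) (K : R) : 0 <= K ->
  (forall t, 0 < t -> is_path_derive F t (euler_integrand z t)) ->
  (forall t, 0 < t -> Cmod (euler_integrand z t) * t ^ 2 <= K / (1 + t) ^ 2) ->
  exists L, forall a, 1 <= a -> Cmod (F a - L) <= 2 * (K / (1 + a)).
Proof.
  intros HK HF HKt. apply (path_limit_at_infty F (fun a => 2 * (K / (1 + a)))).
  - intros a b Hab. apply Rle_trans with (2 * (- (K / (1 + b)) - - (K / (1 + a)))).
    + apply (path_increment_le F (euler_integrand z)
        (fun t => - (K / (1 + t))) (fun t => K / (1 + t) ^ 2)); [lra| | |].
      * intros t Ht. apply HF; lra.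
      * intros t Ht. apply is_derive_opp_inv_shift; lra.
      * intros t Ht. eapply Rle_trans; [|apply HKt; lra].
        rewrite <- (Rmult_1_r (Cmod _)) at 1.
        apply Rmult_le_compat_l; [apply Cmod_ge_0 | nra].
    + assert (0 <= K / (1 + b)) by (apply Rdiv_le_0_compat; lra). lra.
  - apply (filterlim_comp _ _ _ (fun n => INR n + 1) (fun a => 2 * (K / (1 + a))) _
      (Rbar_locally p_infty)); [|apply is_lim_scal_inv_infty].
    apply (is_lim_seq_plus INR (fun _ => 1) p_infty (Finite 1));
      auto using is_lim_seq_INR, is_lim_seq_const.
    reflexivity.
Qed.

(** The subtracted term is an antiderivative of [t^(z-1) (1 - t/n)^n], rescaled
    from the unit interval. *)
Lemma path_derive_truncation_error (z : C) (F : R -> C) (n : nat) (t : R) :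
  0 < Re z -> (0 < n)%nat -> 0 < t ->
  is_path_derive F t (euler_integrand z t) ->
  is_path_derive (fun u => F u - rpower z (INR n) * beta_primitive n z (u / INR n))%C t
    (rpower (z - 1) t * RtoC (exp (- t) - (1 - t / INR n) ^ n))%C.
Proof.
  intros Hz Hn Ht HF. assert (Pn : 0 < INR n) by now apply lt_0_INR.
  assert (Hq : 0 < t / INR n) by now apply Rdiv_lt_0_compat.
  eapply path_derive_eq.
  - apply path_derive_minus; [exact HF|]. apply path_derive_scal.
    apply (path_derive_comp (beta_primitive n z) (fun u => u / INR n)).
    + apply path_derive_beta_primitive; auto.
    + instantiate (1 := / INR n). auto_derive; auto. field; lra.
  - unfold euler_integrand. rewrite (rpower_minus_one z (INR n) Pn).
    replace (rpower (z - 1) t)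
      with (rpower (z - 1) (INR n) * rpower (z - 1) (t / INR n))%C.
    + rewrite RtoC_minus, RtoC_inv by lra. field. intros E; apply RtoC_inj in E; lra.
    + rewrite <- rpower_mult by assumption. f_equal. field; lra.
Qed.

(** Gauss's product is the integral of [t^(z-1) (1 - t/n)^n] over [0, n]. By
    [exp_minus_pow_bounds] this integrand differs from Euler's by at
    most [t^2 / n] times the latter, and that bound has integral of order
    [1 / n]; [L0] is the limit of [F]
    at 0, so the left-hand side compares the two integrals over [0, n]. *)
Lemma gauss_product_error (z : C) (F : R -> C) (K : R) (L0 : C) (n : nat) :
  0 < Re z -> 0 <= K -> (0 < n)%nat ->
  (forall t, 0 < t -> is_path_derive F t (euler_integrand z t)) ->
  (forall t, 0 < t -> Cmod (euler_integrand z t) * t ^ 2 <= K / (1 + t) ^ 2) ->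
  (forall b, 0 < b <= 1 -> Cmod (F b - L0) <= 2 / Re z * exp (Re z * ln b)) ->
  Cmod ((F (INR n) - gauss_product n z) - L0)%C <= 2 * K * / INR n.
Proof.
  intros Hz HK Hn HF HKt HL0. assert (Pn : 0 < INR n) by now apply lt_0_INR.
  set (D := fun t => (F t - rpower z (INR n) * beta_primitive n z (t / INR n))%C).
  assert (DI : forall a, 0 < a <= INR n -> Cmod (D (INR n) - D a)%C <= 2 * K * / INR n).
  { intros a Ha.
    apply Rle_trans with (2 * (- ((K / INR n) / (1 + INR n)) - - ((K / INR n) / (1 + a)))).
    - apply (path_increment_le D
       (fun t => rpower (z - 1) t * RtoC (exp (- t) - (1 - t / INR n) ^ n))%C
       (fun t => - ((K / INR n) / (1 + t))) (fun t => (K / INR n) / (1 + t) ^ 2)); [lra| | |].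
      + intros t Ht. apply path_derive_truncation_error; auto; [lra|]. apply HF; lra.
      + intros t Ht. apply is_derive_opp_inv_shift; lra.
      + intros t Ht. rewrite Cmod_mult, Cmod_rpower, Cmod_R.
        destruct (exp_minus_pow_bounds n t Hn ltac:(lra)) as [b1 b2].
        rewrite Rabs_pos_eq by exact b1.
        replace (Re (z - 1)) with (Re z - 1) by (c_simpl; ring).
        assert (X := HKt t ltac:(lra)). rewrite Cmod_euler_integrand in X.
        apply Rle_trans with (exp ((Re z - 1) * ln t) * (t ^ 2 * exp (- t) / INR n)).
        * apply Rmult_le_compat_l; auto. left; apply exp_pos.
        * apply Rmult_le_reg_r with (INR n); auto.
          replace (K / INR n / (1 + t) ^ 2 * INR n) with (K / (1 + t) ^ 2) by (field; lra).
          replace (exp ((Re z - 1) * ln t) * (t ^ 2 * exp (- t) / INR n) * INR n)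
            with (exp ((Re z - 1) * ln t) * exp (- t) * t ^ 2) by (field; lra).
          exact X.
    - assert (Q : 0 <= K / INR n) by (apply Rdiv_le_0_compat; lra).
      assert (0 <= K / INR n / (1 + INR n)) by (apply Rdiv_le_0_compat; lra).
      assert (K / INR n / (1 + a) <= K / INR n).
      { apply Rmult_le_reg_r with (1 + a); [lra|]. unfold Rdiv at 1.
        rewrite (Rmult_assoc (K / INR n)), Rinv_l by lra. nra. }
      unfold Rdiv in *. lra. }
  assert (En : D (INR n) = (F (INR n) - gauss_product n z)%C).
  { unfold D, gauss_product. rewrite Rdiv_diag, beta_primitive_1 by (auto; lra).
    reflexivity. }
  rewrite <- En. destruct (beta_primitive_bound n z Hz) as [Kb HKb].
  (* D a tends to L0 as a tends to 0, so L0 may replace D a in the bound DI *)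
  apply le_epsilon. intros eps He.
  set (c := exp (Re z * ln (INR n)) * Rabs Kb * exp (- (Re z * ln (INR n)))).
  assert (Hd : at_right 0 (fun a => 2 / Re z * exp (Re z * ln a) < eps / 2 /\
                                    c * exp (Re z * ln a) < eps / 2)).
  { apply filter_and;
      apply (filterlim_scal_power_0 _ _ Hz (fun v => v < eps / 2)), open_lt; lra. }
  assert (Hr : at_right 0 (fun a => 0 < a <= 1 /\ a <= INR n)).
  { assert (Hmin : 0 < Rmin 1 (INR n)) by (apply Rmin_pos; lra).
    exists (mkposreal _ Hmin). intros y Hy Hy0.
    assert (Hy' : Rabs (y - 0) < Rmin 1 (INR n)) by exact Hy.
    apply Rabs_lt_between in Hy'. generalize (Rmin_l 1 (INR n)) (Rmin_r 1 (INR n)). lra. }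
  destruct (filter_ex (F := at_right 0) _ (filter_and _ _ Hd Hr))
    as [a [[Ha0 Ha1] [Ha2 Ha3]]].
  assert (G1 := DI a (conj (proj1 Ha2) Ha3)).
  assert (G2 : Cmod (D a - L0)%C <= eps).
  { apply Rle_trans with (2 / Re z * exp (Re z * ln a) + c * exp (Re z * ln a)); [|lra].
    unfold D.
    replace (F a - rpower z (INR n) * beta_primitive n z (a / INR n) - L0)%C
      with ((F a - L0) - rpower z (INR n) * beta_primitive n z (a / INR n))%C by ring.
    eapply Rle_trans; [apply Cmod_minus_le|]. apply Rplus_le_compat; [now apply HL0|].
    unfold c. rewrite Cmod_mult, Cmod_rpower, !Rmult_assoc.
    apply Rmult_le_compat_l; [left; apply exp_pos|].
    eapply Rle_trans; [apply HKb|].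
    { split; [apply Rdiv_lt_0_compat; lra|].
      apply Rmult_le_reg_r with (INR n); auto. unfold Rdiv.
      rewrite Rmult_assoc, Rinv_l; lra. }
    rewrite ln_div by lra. rewrite <- exp_plus.
    replace (Re z * (ln a - ln (INR n))) with (- (Re z * ln (INR n)) + Re z * ln a) by ring.
    apply Rmult_le_compat_r; [left; apply exp_pos | apply Rle_abs]. }
  replace (D (INR n) - L0)%C with ((D (INR n) - D a) + (D a - L0))%C by ring.
  eapply Rle_trans; [apply Cmod_triangle|]. lra.
Qed.

Lemma Gamma_gauss (z : C) : 0 < Re z -> C_lim_seq (fun n => gauss_product n z) (Gamma z).
Proof.
  intros Hz.
  destruct (ex_path_antiderivative _ (path_continuous_euler_integrand z)) as [F HF].
  destruct (euler_integrand_decay z Hz) as [K [HK HKt]].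
  destruct (euler_primitive_at_0 z F Hz HF) as [L0 HL0].
  destruct (euler_primitive_at_infty z F K HK HF HKt) as [L1 HL1].
  assert (EG : Gamma z = (L1 - L0)%C).
  { unfold Gamma. apply (is_RInt_gen_unique (V := C_R_CompleteNormedModule)).
    apply (is_RInt_gen_antiderivative F (euler_integrand z) L0 L1 _ _) with (3 := HL0) (4 := HL1).
    - intros t Ht. split; [now apply HF | now apply path_continuous_euler_integrand].
    - intros t Ht. unfold euler_integrand. now rewrite Cpower_RtoC.
    - now apply filterlim_scal_power_0.
    - apply is_lim_scal_inv_infty. }
  rewrite EG. apply (is_lim_seq_incr_1 (fun n => Cmod (gauss_product n z - (L1 - L0)))).
  apply (C_lim_seq_dominated (fun n => gauss_product (S n) z) (L1 - L0)%C
    (fun n => 4 * K * / (INR n + 1))).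
  - intros n.
    assert (G1 := gauss_product_error z F K L0 (S n) Hz HK (Nat.lt_0_succ n) HF HKt HL0).
    rewrite S_INR in G1. assert (Pn := pos_INR n).
    assert (G2 := HL1 (INR n + 1) ltac:(lra)).
    replace (gauss_product (S n) z - (L1 - L0))%C
      with ((F (INR n + 1)%R - L1) - (F (INR n + 1)%R - gauss_product (S n) z - L0))%C by ring.
    eapply Rle_trans; [apply Cmod_minus_le|].
    assert (2 * (K / (1 + (INR n + 1))) <= 2 * K * / (INR n + 1)).
    { unfold Rdiv. rewrite <- Rmult_assoc. apply Rmult_le_compat_l; [lra|].
      apply Rinv_le_contravar; lra. }
    lra.
  - apply is_lim_seq_scal_0, is_lim_seq_inv_S.
Qed.

(** * The quotient of Gamma values *)

Lemma exp_2 (a : R) : exp a ^ 2 = exp (2 * a).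
Proof. rewrite <- (exp_mult_INR 2). reflexivity. Qed.

Lemma Cmod_factor_le (z : C) (k : R) : 0 < k ->
  Cmod (z + RtoC k) <= k * exp (Re z / k + Cmod z ^ 2 / k ^ 2).
Proof.
  intros Hk.
  assert (X := exp_pos (Re z / k + Cmod z ^ 2 / k ^ 2)).
  apply Rsqr_incr_0_var; [|left; now apply Rmult_lt_0_compat].
  rewrite !Rsqr_pow2, Rpow_mult_distr, exp_2.
  apply Rle_trans with (k ^ 2 * (1 + 2 * (Re z / k + Cmod z ^ 2 / k ^ 2))).
  - replace (k ^ 2 * (1 + 2 * (Re z / k + Cmod z ^ 2 / k ^ 2)))
      with (k ^ 2 + 2 * k * Re z + 2 * Cmod z ^ 2) by (field; lra).
    rewrite !Cmod2_alt. c_simpl. nra.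
  - apply Rmult_le_compat_l; [nra|]. apply exp_ineq1_le.
Qed.

(** Multiply the bounds of [Cmod_factor_le] for [k = 1, ..., n + 1]; the sum of the
    [1/k] is at most [1 + ln (n + 1)] and that of the [1/k^2] at most
    [2 - 1/(n + 1)]. *)
Lemma rising_bound (z : C) (n : nat) : 0 < Re z ->
  Cmod (rising z (S n)) <=
  Cmod z * INR (fact (S n)) *
  exp (Re z * (1 + ln (INR n + 1)) + Cmod z ^ 2 * (2 - / (INR n + 1))).
Proof.
  intros Hz. induction n as [|n IH].
  - unfold rising. simpl Cprod. rewrite Cmult_1_l, Cmod_mult. simpl.
    rewrite Cplus_0_r, Rplus_0_l, ln_1.
    assert (H := Cmod_factor_le z 1 Rlt_0_1).
    replace (1 * exp (Re z / 1 + Cmod z ^ 2 / 1 ^ 2)) with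
      (exp (Re z * (1 + 0) + Cmod z * (Cmod z * 1) * (2 - / 1))) in H.
    + rewrite Rmult_1_r in H |- *. apply Rmult_le_compat_l; [apply Cmod_ge_0 | exact H].
    + rewrite Rmult_1_l. f_equal. field.
  - assert (Pn := pos_INR n).
    assert (E : rising z (S (S n)) = (rising z (S n) * (z + RtoC (INR (S (S n)))))%C) by reflexivity.
    rewrite E, Cmod_mult, (fact_simpl (S n)), mult_INR.
    set (k := INR (S (S n))). assert (Hk : k = INR n + 2) by (unfold k; rewrite !S_INR; ring).
    assert (Hk0 : 0 < k) by lra.
    eapply Rle_trans.
    { apply Rmult_le_compat; [apply Cmod_ge_0 | apply Cmod_ge_0 | apply IH | apply Cmod_factor_le, Hk0]. }
    set (A := Cmod z * INR (fact (S n))).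
    assert (HA : 0 <= A) by (apply Rmult_le_pos; [apply Cmod_ge_0 | apply pos_INR]).
    replace (Cmod z * (k * INR (fact (S n)))) with (A * k) by (unfold A; ring).
    match goal with |- A * exp ?u * (k * exp ?v) <= _ =>
      replace (A * exp u * (k * exp v)) with (A * k * exp (u + v)) by (rewrite exp_plus; ring) end.
    apply Rmult_le_compat_l; [now apply Rmult_le_pos; [|lra]|].
    apply exp_le. rewrite S_INR.
    replace (INR n + 1 + 1) with k by lra.
    assert (L1 : / k <= ln k - ln (INR n + 1)).
    { rewrite <- ln_div by lra.
      assert (ln ((INR n + 1) / k) <= - / k).
      { generalize (exp_ineq1_le (ln ((INR n + 1) / k))).
        rewrite exp_ln by (apply Rdiv_lt_0_compat; lra).
        replace ((INR n + 1) / k) with (1 - / k) at 2 by (rewrite Hk; field; lra). lra. }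
      rewrite ln_div in * by lra. lra. }
    assert (L2 : / k ^ 2 <= / (INR n + 1) - / k).
    { replace (/ (INR n + 1) - / k) with (/ ((INR n + 1) * k)) by (rewrite Hk; field; lra).
      apply Rinv_le_contravar; nra. }
    assert (0 <= Cmod z ^ 2) by apply pow2_ge_0.
    unfold Rdiv. nra.
Qed.

(** By [rising_bound] Gauss's products stay away from 0. *)
Lemma Gamma_neq_0 (z : C) : 0 < Re z -> Gamma z <> RtoC 0.
Proof.
  intros Hz E. assert (H := Gamma_gauss z Hz). rewrite E in H.
  assert (Hm := Cmod_pos_of_Re z Hz).
  set (c := / (Cmod z * exp (Re z + Cmod z ^ 2 * 2))).
  assert (Hc : 0 < c) by (apply Rinv_0_lt_compat, Rmult_lt_0_compat; auto; apply exp_pos).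
  apply C_lim_seq_Cmod in H. rewrite Cmod_0 in H.
  destruct (is_lim_seq_0_eventually _ c H Hc) as [N HN].
  specialize (HN (S N) (Nat.le_succ_diag_r N)). apply (Rlt_not_le _ _ HN).
  unfold gauss_product. rewrite Cmod_mult, Cmod_rpower, Cmod_div by now apply rising_neq_0.
  rewrite Cmod_R, Rabs_pos_eq by apply pos_INR.
  assert (HR : 0 < Cmod (rising z (S N))) by now apply Cmod_gt_0, rising_neq_0.
  apply Rmult_le_reg_r with (Cmod (rising z (S N))); auto.
  replace (exp (Re z * ln (INR (S N))) * (INR (fact (S N)) / Cmod (rising z (S N))) * Cmod (rising z (S N)))
    with (exp (Re z * ln (INR (S N))) * INR (fact (S N))) by (field; lra).
  eapply Rle_trans; [apply Rmult_le_compat_l; [lra | now apply rising_bound]|].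
  assert (PN := pos_INR N). rewrite S_INR. unfold c.
  assert (Hf := pos_INR (fact (S N))).
  assert (X : exp (Re z * (1 + ln (INR N + 1)) + Cmod z ^ 2 * (2 - / (INR N + 1)))
     <= exp (Re z + Cmod z ^ 2 * 2) * exp (Re z * ln (INR N + 1))).
  { rewrite <- exp_plus. apply exp_le.
    assert (0 <= / (INR N + 1)) by (left; apply Rinv_0_lt_compat; lra).
    assert (0 <= Cmod z ^ 2) by apply pow2_ge_0. nra. }
  assert (Y := exp_pos (Re z + Cmod z ^ 2 * 2)).
  apply Rle_trans with (/ (Cmod z * exp (Re z + Cmod z ^ 2 * 2)) *
    (Cmod z * INR (fact (S N)) * (exp (Re z + Cmod z ^ 2 * 2) * exp (Re z * ln (INR N + 1))))).
  - apply Rmult_le_compat_l; [left; exact Hc|]. apply Rmult_le_compat_l; auto.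
    apply Rmult_le_pos; lra.
  - apply Req_le. field. lra.
Qed.

Lemma gauss_product_ratio (x : C) (n : nat) : 0 < Re x -> (0 < n)%nat ->
  (gauss_product n (x / 2) / gauss_product n ((x + 1) / 2) =
   RtoC (/ sqrt (INR n)) * Cprod (odd_even_ratio x) (S n))%C.
Proof.
  intros Hx Hn. assert (Pn : 0 < INR n) by now apply lt_0_INR.
  assert (R2 : RtoC 2 <> RtoC 0) by (intros E; apply RtoC_inj in E; lra).
  assert (H1 : 0 < Re (x / 2)).
  { replace (Re (x / 2)) with (Re x / 2) by (c_simpl; field). lra. }
  assert (H2 : 0 < Re ((x + 1) / 2)).
  { replace (Re ((x + 1) / 2)) with ((Re x + 1) / 2) by (c_simpl; field). lra. }
  assert (HR : forall m, Cprod (odd_even_ratio x) (S m) =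
     (rising ((x + 1) / 2) m / rising (x / 2) m)%C).
  { intros m. unfold rising. induction (S m) as [|p IH].
    - simpl. field.
    - simpl Cprod. rewrite IH. unfold odd_even_ratio.
      assert (N1 : Cprod (fun j => x / 2 + RtoC (INR j))%C p <> RtoC 0).
      { apply Cprod_neq_0. intros j. now apply Re_pos_neq_0, Re_add_INR_pos. }
      assert (N2 : (RtoC (2 * INR p) + x)%C <> RtoC 0).
      { apply Re_pos_neq_0, Re_shift_pos; auto. generalize (pos_INR p); lra. }
      rewrite RtoC_plus, !RtoC_mult in *. field. repeat split; auto.
      intros E. apply N2. rewrite <- E. ring. }
  unfold gauss_product. rewrite HR.
  assert (G1 := rising_neq_0 _ n H1). assert (G2 := rising_neq_0 _ n H2).
  replace ((x + 1) / 2)%C with (x / 2 + / 2)%C at 1 by (field; auto).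
  rewrite rpower_plus.
  assert (E : rpower (/ 2) (INR n) = RtoC (sqrt (INR n))).
  { unfold rpower. rewrite <- RtoC_inv, <- RtoC_mult, Cexp_RtoC by lra. f_equal.
    rewrite <- Rpower_sqrt by auto. reflexivity. }
  rewrite E, RtoC_inv.
  2:{ apply Rgt_not_eq, sqrt_lt_R0, Pn. }
  assert (F1 : RtoC (INR (fact n)) <> RtoC 0).
  { intros F. apply RtoC_inj in F. apply (INR_fact_neq_0 n F). }
  assert (F2 : RtoC (sqrt (INR n)) <> RtoC 0).
  { intros F. apply RtoC_inj in F. generalize (sqrt_lt_R0 _ Pn). lra. }
  assert (F3 : rpower (x / 2) (INR n) <> RtoC 0) by apply Cexp_neq_0.
  field. repeat split; auto.
Qed.

Lemma is_lim_seq_sqrt_ratio :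
  is_lim_seq (fun n => sqrt (2 * INR (S n)) / sqrt (INR n)) (sqrt 2).
Proof.
  apply is_lim_seq_ext_loc with (fun n => sqrt (2 + 2 * / INR n)).
  - exists 1%nat. intros n Hn. assert (Pn : 0 < INR n) by (apply lt_0_INR; lia).
    rewrite <- sqrt_div by (rewrite ?S_INR; lra). f_equal. rewrite S_INR. field. lra.
  - apply (is_lim_seq_continuous sqrt (fun n => 2 + 2 * / INR n) 2).
    { apply continuity_pt_sqrt; lra. }
    replace (Finite 2) with (Finite (2 + 2 * 0)) by (f_equal; ring).
    apply is_lim_seq_plus'; [apply is_lim_seq_const|].
    apply is_lim_seq_mult'; [apply is_lim_seq_const|].
    apply (is_lim_seq_inv INR p_infty); [apply is_lim_seq_INR | discriminate].
Qed.

Lemma barGamma1_Gamma (x : C) : 0 < Re x ->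
  barGamma1 x =
    (RtoC (1 / sqrt 2) * (Gamma (x / RtoC 2) / Gamma ((x + RtoC 1) / RtoC 2)))%C.
Proof.
  intros Hx.
  assert (S2 : 0 < sqrt 2) by (apply sqrt_lt_R0; lra).
  assert (H1 : 0 < Re (x / 2)).
  { replace (Re (x / 2)) with (Re x / 2) by (c_simpl; field). lra. }
  assert (H2 : 0 < Re ((x + 1) / 2)).
  { replace (Re ((x + 1) / 2)) with ((Re x + 1) / 2) by (c_simpl; field). lra. }
  assert (L1 := C_lim_seq_div _ _ _ _ (Gamma_neq_0 _ H2) (Gamma_gauss _ H1) (Gamma_gauss _ H2)).
  assert (L2 := barGamma1_limit x Hx).
  assert (L3 : C_lim_seq (fun n => Cprod (odd_even_ratio x) (S n) * RtoC (/ sqrt (2 * INR (S n))))%C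
                 (barGamma1 x)).
  { apply (is_lim_seq_incr_1 (fun M => Cmod (Cprod (odd_even_ratio x) M
             * RtoC (/ sqrt (2 * INR M)) - barGamma1 x))). exact L2. }
  assert (L4 := C_lim_seq_mult _ _ _ _ L3 (C_lim_seq_RtoC _ _ is_lim_seq_sqrt_ratio)).
  assert (E : (Gamma (x / 2) / Gamma ((x + 1) / 2))%C = (barGamma1 x * RtoC (sqrt 2))%C).
  { apply (C_lim_seq_unique _ _ _ L1). revert L4. apply C_lim_seq_ext_loc.
    exists 1%nat. intros n Hn. assert (Pn : 0 < INR n) by (apply lt_0_INR; lia).
    rewrite gauss_product_ratio by (auto; lia).
    assert (Q1 : 0 < sqrt (INR n)) by now apply sqrt_lt_R0.
    assert (Q2 : 0 < sqrt (2 * INR (S n))) by (apply sqrt_lt_R0; rewrite S_INR; lra).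
    rewrite <- Cmult_assoc, <- RtoC_mult, Cmult_comm. f_equal. f_equal. field. lra. }
  rewrite E, (Cmult_comm (barGamma1 x)), Cmult_assoc, <- RtoC_mult.
  replace (1 / sqrt 2 * sqrt 2) with 1 by (field; lra). ring.
Qed.

(** * Wallis's product *)

Definition wallis (n : nat) : R := RInt (fun t => sin t ^ n) 0 (PI / 2).

Lemma continuous_sin_pow (n : nat) (t : R) : continuous (fun u => sin u ^ n) t.
Proof.
  apply (ex_derive_continuous (V := R_NormedModule)). auto_derive; auto.
Qed.

Lemma is_RInt_wallis (n : nat) : is_RInt (fun t => sin t ^ n) 0 (PI / 2) (wallis n).
Proof.
  apply (RInt_correct (V := R_CompleteNormedModule)), ex_RInt_continuous.
  intros; apply continuous_sin_pow.
Qed.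

Lemma wallis_0 : wallis 0 = PI / 2.
Proof.
  unfold wallis. simpl. rewrite RInt_const. unfold scal; simpl; unfold mult; simpl. lra.
Qed.

Lemma wallis_1 : wallis 1 = 1.
Proof.
  assert (H : is_RInt (fun t => sin t ^ 1) 0 (PI / 2) (minus (- cos (PI / 2)) (- cos 0))).
  { apply (is_RInt_derive (V := R_CompleteNormedModule) (fun t => - cos t)).
    - intros t _. auto_derive; auto. ring.
    - intros; apply continuous_sin_pow. }
  unfold wallis. rewrite (is_RInt_unique _ _ _ _ H), cos_PI2, cos_0.
  unfold minus, plus, opp; simpl. ring.
Qed.

(** Integrate the derivative of [sin^(n+1) cos], which vanishes at both ends. *)
Lemma wallis_rec (n : nat) : (INR n + 2) * wallis (S (S n)) = (INR n + 1) * wallis n.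
Proof.
  assert (H1 : is_RInt (fun t => (INR n + 1) * sin t ^ n - (INR n + 2) * sin t ^ S (S n)) 0 (PI / 2)
    ((INR n + 1) * wallis n - (INR n + 2) * wallis (S (S n)))).
  { apply (is_RInt_minus (V := R_NormedModule) (fun t => (INR n + 1) * sin t ^ n));
      apply (is_RInt_scal (V := R_NormedModule)), is_RInt_wallis. }
  assert (H2 : is_RInt (fun t => (INR n + 1) * sin t ^ n - (INR n + 2) * sin t ^ S (S n)) 0 (PI / 2)
    (minus (sin (PI / 2) ^ S n * cos (PI / 2)) (sin 0 ^ S n * cos 0))).
  { apply (is_RInt_derive (V := R_CompleteNormedModule) (fun t => sin t ^ S n * cos t)).
    - intros t _. eapply is_derive_eq.
      + apply (is_derive_mult (K := R_AbsRing) (fun t => sin t ^ S n) cos);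
          [|apply is_derive_cos|intros; apply Rmult_comm].
        apply is_derive_pow, is_derive_sin.
      + unfold plus, mult; simpl pred; cbn -[INR pow].
        rewrite S_INR. simpl pow.
        replace ((INR n + 1) * cos t * sin t ^ n * cos t)
          with ((INR n + 1) * sin t ^ n * (cos t)²) by (unfold Rsqr; ring).
        rewrite cos2. unfold Rsqr. ring.
    - intros t _. apply (ex_derive_continuous (V := R_NormedModule)). auto_derive; auto. }
  assert (E := is_RInt_unique _ _ _ _ H1). rewrite (is_RInt_unique _ _ _ _ H2) in E.
  rewrite cos_PI2, sin_0, pow_i in E by lia.
  unfold minus, plus, opp in E; simpl in E. simpl. lra.
Qed.

Lemma wallis_decr (n : nat) : wallis (S n) <= wallis n.
Proof.
  assert (P := PI_RGT_0).
  apply (is_RInt_le (fun t => sin t ^ S n) (fun t => sin t ^ n) 0 (PI / 2));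
    [lra | apply is_RInt_wallis | apply is_RInt_wallis|].
  intros t Ht. simpl.
  assert (0 <= sin t) by (apply sin_ge_0; lra).
  assert (0 <= sin t ^ n) by now apply pow_le.
  generalize (SIN_bound t). nra.
Qed.

Fixpoint wallis_product (M : nat) : R :=
  match M with O => 1 | S k => wallis_product k * ((2 * INR k + 2) / (2 * INR k + 1)) end.

Lemma wallis_product_pos (M : nat) : 0 < wallis_product M.
Proof.
  induction M as [|M IH]; simpl; [lra|]. assert (P := pos_INR M).
  apply Rmult_lt_0_compat; auto. apply Rdiv_lt_0_compat; lra.
Qed.

Lemma wallis_even (M : nat) : wallis (2 * M) = PI / 2 / wallis_product M.
Proof.
  induction M as [|M IH].
  - simpl. rewrite wallis_0. field.
  - replace (2 * S M)%nat with (S (S (2 * M))) by lia.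
    assert (R := wallis_rec (2 * M)). rewrite IH, mult_INR in R. change (INR 2) with 2 in R.
    assert (P := pos_INR M). assert (Q := wallis_product_pos M).
    apply Rmult_eq_reg_l with (2 * INR M + 2); [|lra]. rewrite R.
    simpl wallis_product. field. lra.
Qed.

Lemma wallis_odd (M : nat) : wallis (S (2 * M)) = wallis_product M / (2 * INR M + 1).
Proof.
  induction M as [|M IH].
  - simpl. rewrite wallis_1. field.
  - replace (S (2 * S M)) with (S (S (S (2 * M)))) by lia.
    assert (R := wallis_rec (S (2 * M))).
    rewrite IH, S_INR, mult_INR in R. change (INR 2) with 2 in R.
    assert (P := pos_INR M). assert (Q := wallis_product_pos M).
    apply Rmult_eq_reg_l with (2 * INR M + 1 + 2); [|lra]. rewrite R.
    rewrite S_INR. simpl wallis_product. field. lra.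
Qed.

(** Compare the consecutive integrals of index [2M], [2M + 1] and [2M + 2]. *)
Lemma wallis_product_sq_bounds (M : nat) :
  PI / 2 * ((2 * INR M + 1) ^ 2 / (2 * INR M + 2)) <= wallis_product M ^ 2
    <= PI / 2 * (2 * INR M + 1).
Proof.
  assert (P := pos_INR M). assert (Q := wallis_product_pos M).
  split.
  - assert (H := wallis_decr (S (2 * M))).
    replace (S (S (2 * M))) with (2 * S M)%nat in H by lia.
    rewrite wallis_even, wallis_odd in H. simpl wallis_product in H.
    apply (Rmult_le_compat_r ((2 * INR M + 1) * wallis_product M)) in H; [|nra].
    replace (wallis_product M / (2 * INR M + 1) * ((2 * INR M + 1) * wallis_product M))
      with (wallis_product M ^ 2) in H by (field; lra).
    eapply Rle_trans; [|exact H]. apply Req_le. field. repeat split; lra.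
  - assert (H := wallis_decr (2 * M)). rewrite wallis_even, wallis_odd in H.
    apply (Rmult_le_compat_r ((2 * INR M + 1) * wallis_product M)) in H; [|nra].
    replace (wallis_product M / (2 * INR M + 1) * ((2 * INR M + 1) * wallis_product M))
      with (wallis_product M ^ 2) in H by (field; lra).
    eapply Rle_trans; [exact H|]. apply Req_le. field. lra.
Qed.

Lemma wallis_limit :
  is_lim_seq (fun M => wallis_product M / sqrt (2 * INR M)) (sqrt (PI / 2)).
Proof.
  assert (P := PI_RGT_0).
  assert (I0 : is_lim_seq (fun n => / INR n) 0).
  { apply (is_lim_seq_inv INR p_infty); [apply is_lim_seq_INR | discriminate]. }
  assert (L : is_lim_seq (fun M => wallis_product M ^ 2 / (2 * INR M)) (PI / 2)).
  { apply is_lim_seq_le_le_loc with (u := fun _ => PI / 2)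
      (w := fun n => PI / 2 + PI / 4 * / INR n).
    - exists 1%nat. intros n Hn. assert (Pn : 0 < INR n) by (apply lt_0_INR; lia).
      destruct (wallis_product_sq_bounds n) as [b1 b2].
      split; (apply Rmult_le_reg_r with (2 * INR n); [lra|]);
        replace (wallis_product n ^ 2 / (2 * INR n) * (2 * INR n))
          with (wallis_product n ^ 2) by (field; lra).
      + eapply Rle_trans; [|exact b1]. apply Rmult_le_compat_l; [lra|].
        apply Rmult_le_reg_r with (2 * INR n + 2); [lra|].
        replace ((2 * INR n + 1) ^ 2 / (2 * INR n + 2) * (2 * INR n + 2))
          with ((2 * INR n + 1) ^ 2) by (field; lra). nra.
      + eapply Rle_trans; [exact b2|]. apply Req_le. field. lra.
    - apply is_lim_seq_const.
    - replace (Finite (PI / 2)) with (Finite (PI / 2 + PI / 4 * 0)) by (f_equal; ring).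
      apply is_lim_seq_plus'; [apply is_lim_seq_const|].
      apply is_lim_seq_mult'; [apply is_lim_seq_const | exact I0]. }
  apply is_lim_seq_ext_loc with (fun M => sqrt (wallis_product M ^ 2 / (2 * INR M))).
  - exists 1%nat. intros n Hn. assert (Pn : 0 < INR n) by (apply lt_0_INR; lia).
    rewrite sqrt_div by (try apply pow2_ge_0; lra).
    rewrite sqrt_pow2; [reflexivity | left; apply wallis_product_pos].
  - apply (is_lim_seq_continuous sqrt _ (PI / 2)); auto.
    apply continuity_pt_sqrt; lra.
Qed.

Lemma Cprod_odd_even_ratio_1 (M : nat) :
  Cprod (odd_even_ratio 1) M = RtoC (wallis_product M).
Proof.
  induction M as [|M IH]; [reflexivity|].
  simpl. rewrite IH, RtoC_mult. f_equal. unfold odd_even_ratio.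
  rewrite <- !RtoC_plus, <- RtoC_div by (generalize (pos_INR M); lra).
  f_equal. f_equal. ring.
Qed.

Lemma Re_1_pos : 0 < Re (RtoC 1).
Proof. c_simpl; lra. Qed.

Lemma barGamma1_1 : barGamma1 (RtoC 1) = RtoC (sqrt (PI / 2)).
Proof.
  apply (C_lim_seq_unique _ _ _ (barGamma1_limit 1 Re_1_pos)).
  apply C_lim_seq_ext with (2 := C_lim_seq_RtoC _ _ wallis_limit).
  intros M. now rewrite Cprod_odd_even_ratio_1, <- RtoC_mult.
Qed.

(** * The modified gamma function *)

(** The Taylor polynomial of [ln (1 + t)]; keeping [t] free turns the
    estimate at [t = 1] into one of derivatives. *)
Fixpoint alt_harmonic (n : nat) (t : R) : R :=
  match n with O => 0 | S k => alt_harmonic k t + (-1) ^ k * t ^ S k / INR (S k) end.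

Lemma is_derive_alt_harmonic (n : nat) (t : R) : 0 <= t ->
  is_derive (alt_harmonic n) t ((1 - (- t) ^ n) / (1 + t)).
Proof.
  intros Ht. induction n as [|n IH].
  - eapply is_derive_eq; [apply (is_derive_const (V := R_NormedModule) 0 t)|].
    simpl. unfold zero; simpl. field. lra.
  - eapply is_derive_eq.
    + apply (is_derive_plus (V := R_NormedModule) (alt_harmonic n)
        (fun t => (-1) ^ n * t ^ S n / INR (S n))); [exact IH|].
      instantiate (1 := (-1) ^ n * t ^ n).
      auto_derive; auto.
      change (match n with O => 1 | S _ => INR n + 1 end) with (INR (S n)).
      change (Init.Nat.pred (S n)) with n. field. apply not_0_INR. lia.
    + unfold plus; simpl plus. cbn -[pow].
      replace (- t) with ((-1) * t) by ring. rewrite !Rpow_mult_distr. simpl. field. lra.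
Qed.

Lemma alt_harmonic_ln_2 (n : nat) : Rabs (ln 2 - alt_harmonic n 1) <= / (INR n + 1).
Proof.
  assert (Pn := pos_INR n).
  assert (H := real_increment_le (fun t => ln (1 + t) - alt_harmonic n t)
    (fun t => (- t) ^ n / (1 + t)) (fun t => t ^ S n / (INR n + 1)) (fun t => t ^ n) 0 1 Rle_0_1).
  assert (E0 : alt_harmonic n 0 = 0).
  { clear. induction n as [|n IH]; [reflexivity|]. cbn [alt_harmonic].
    rewrite IH, pow_i by lia. unfold Rdiv. ring. }
  cbv beta in H. rewrite E0, Rplus_0_r, ln_1, pow1, pow_i, Rminus_0_r, Rminus_0_r in H by lia.
  replace (1 + 1) with 2 in H by ring.
  replace (1 / (INR n + 1) - 0 / (INR n + 1)) with (/ (INR n + 1)) in H by (field; lra).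
  apply H. intros t Ht. split; [|split].
  - eapply is_derive_eq.
    + apply (is_derive_minus (V := R_NormedModule) (fun t => ln (1 + t)) (alt_harmonic n)).
      * instantiate (1 := / (1 + t)). auto_derive; [lra|]. field. lra.
      * apply is_derive_alt_harmonic. lra.
    + unfold minus, plus, opp; simpl. field. lra.
  - auto_derive; auto.
    change (match n with O => 1 | S _ => INR n + 1 end) with (INR (S n)).
    rewrite S_INR. field. lra.
  - unfold Rdiv. rewrite Rabs_mult, <- RPow_abs, Rabs_Ropp, (Rabs_pos_eq t) by lra.
    assert (0 < / (1 + t)) by (apply Rinv_0_lt_compat; lra).
    assert (/ (1 + t) <= 1) by (rewrite <- Rinv_1; apply Rinv_le_contravar; lra).
    assert (0 <= t ^ n) by (apply pow_le; lra).
    rewrite Rabs_pos_eq by lra. nra.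
Qed.

Lemma alt_harmonic_limit : is_lim_seq (fun n => alt_harmonic n 1) (ln 2).
Proof.
  apply is_lim_seq_ext with (fun n => ln 2 - (ln 2 - alt_harmonic n 1)); [intros; ring|].
  replace (Finite (ln 2)) with (Finite (ln 2 - 0)) by (f_equal; ring).
  apply is_lim_seq_minus'; [apply is_lim_seq_const|].
  apply is_lim_seq_abs_0. apply is_lim_seq_squeeze_0 with (2 := is_lim_seq_inv_S).
  intros n; split; [apply Rabs_pos | apply alt_harmonic_ln_2].
Qed.

Definition tGamma_partial (x : C) (n : nat) : C := Cprod (fun k => tGamma_factor x (S k)) n.

Lemma tGamma_factor_odd (x : C) (M : nat) :
  tGamma_factor x (S (2 * M)) =
  (Cexp (- (x / RtoC (INR (S (2 * M))))) * (RtoC 1 + x / RtoC (INR (S (2 * M)))))%C.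
Proof.
  unfold tGamma_factor. rewrite Nat.odd_succ, Nat.even_mul. reflexivity.
Qed.

Lemma tGamma_factor_even (x : C) (M : nat) :
  tGamma_factor x (S (S (2 * M))) =
  (/ (Cexp (- (x / RtoC (INR (S (S (2 * M)))))) * (RtoC 1 + x / RtoC (INR (S (S (2 * M)))))))%C.
Proof.
  unfold tGamma_factor. rewrite Nat.odd_succ, Nat.even_succ, <- Nat.negb_even, Nat.even_mul.
  reflexivity.
Qed.

(** Apart from the exponentials, the factors of index [2j + 1] and [2j + 2]
    multiply to [(2j+1+x)/(2j+2+x) * (2j+2)/(2j+1)]; the last factor accounts for the shift
    from [2j + 2 + x] to the [2j + x] of [odd_even_ratio x]. *)
Lemma tGamma_partial_even (x : C) (M : nat) : 0 < Re x ->
  tGamma_partial x (2 * M) =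
  (Cexp (- (x * RtoC (alt_harmonic (2 * M) 1)))
   * (Cprod (odd_even_ratio x) M * Cprod (odd_even_ratio 1) M)
   * (x / (RtoC (2 * INR M) + x)))%C.
Proof.
  intros Hx. assert (X0 := Re_pos_neq_0 x Hx).
  induction M as [|M IH].
  - simpl. rewrite Rmult_0_r, Cmult_0_r. replace (- RtoC 0)%C with (RtoC 0) by ring.
    rewrite Cexp_0. unfold tGamma_partial; simpl. field. exact X0.
  - replace (2 * S M)%nat with (S (S (2 * M))) by lia.
    unfold tGamma_partial in *. cbn [Cprod]. rewrite IH.
    rewrite tGamma_factor_odd, tGamma_factor_even.
    cbn [alt_harmonic]. rewrite !pow1, <- (tech_pow_Rmult (-1) (2 * M)), pow_1_even.
    set (h := alt_harmonic (2 * M) 1).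
    assert (Pm := pos_INR M).
    set (m := INR M) in *.
    assert (E1 : INR (S (2 * M)) = 2 * m + 1) by (rewrite S_INR, mult_INR; reflexivity).
    assert (E2 : INR (S (S (2 * M))) = 2 * m + 2).
    { rewrite S_INR, E1. ring. }
    assert (E3 : INR (S M) = m + 1) by (rewrite S_INR; reflexivity).
    rewrite E1, E2, E3.
    assert (A1 : RtoC (2 * m + 1) <> RtoC 0) by (intros E; apply RtoC_inj in E; lra).
    assert (A2 : RtoC (2 * m + 2) <> RtoC 0) by (intros E; apply RtoC_inj in E; lra).
    replace (- (x * RtoC (h + 1 * 1 / (2 * m + 1) + -1 * 1 * 1 / (2 * m + 2))))%C
      with (- (x * RtoC h) + - (x / RtoC (2 * m + 1)) - - (x / RtoC (2 * m + 2)))%C.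
    2:{ replace (h + 1 * 1 / (2 * m + 1) + -1 * 1 * 1 / (2 * m + 2))
          with (h + / (2 * m + 1) - / (2 * m + 2)) by (field; lra).
        rewrite RtoC_minus, (RtoC_plus h), !RtoC_inv by lra. unfold Cdiv. ring. }
    rewrite Cexp_minus, Cexp_plus.
    assert (B1 := Cexp_neq_0 (- (x / RtoC (2 * m + 1)))).
    assert (B2 := Cexp_neq_0 (- (x / RtoC (2 * m + 2)))).
    unfold odd_even_ratio. fold m.
    assert (D : forall r : R, 0 <= r -> (RtoC r + x)%C <> RtoC 0).
    { intros r Hr. apply Re_pos_neq_0, Re_shift_pos; auto. }
    assert (D0 := D (2 * m) ltac:(lra)).
    assert (D2 := D (2 * m + 2) ltac:(lra)).
    replace (RtoC (2 * m) + RtoC 1)%C with (RtoC (2 * m + 1)) by (now rewrite RtoC_plus).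
    replace (RtoC (2 * m + 1) + RtoC 1)%C with (RtoC (2 * m + 2))
      by (rewrite <- RtoC_plus; f_equal; ring).
    replace (2 * (m + 1)) with (2 * m + 2) by ring.
    set (a := RtoC (2 * m + 1)) in *. set (b := RtoC (2 * m + 2)) in *.
    set (c := RtoC (2 * m)) in *.
    field. repeat split; auto.
Qed.

Lemma C_lim_seq_x_over (x : C) :
  C_lim_seq (fun n => x / RtoC (INR n))%C (RtoC 0).
Proof.
  apply C_lim_seq_ext_loc with (fun n => x * RtoC (/ INR n))%C.
  - exists 1%nat. intros n Hn. assert (Pn : 0 < INR n) by (apply lt_0_INR; lia).
    rewrite RtoC_inv by lra. reflexivity.
  - replace (RtoC 0) with (x * RtoC 0)%C by ring. apply C_lim_seq_scal, C_lim_seq_RtoC.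
    apply (is_lim_seq_inv INR p_infty); [apply is_lim_seq_INR | discriminate].
Qed.

Lemma C_lim_seq_even_odd (u : nat -> C) (l : C) :
  C_lim_seq (fun n => u (2 * n)%nat) l -> C_lim_seq (fun n => u (S (2 * n))) l ->
  C_lim_seq u l.
Proof.
  intros H1 H2 P [eps HP].
  destruct (is_lim_seq_0_eventually _ eps H1 (cond_pos eps)) as [N1 HN1].
  destruct (is_lim_seq_0_eventually _ eps H2 (cond_pos eps)) as [N2 HN2].
  exists (2 * (N1 + N2))%nat. intros n Hn. apply HP.
  assert (K : Cmod (u n - l) < eps).
  { destruct (Nat.Even_or_Odd n) as [[k ->] | [k ->]].
    - apply HN1. lia.
    - replace (2 * k + 1)%nat with (S (2 * k)) by lia. apply HN2. lia. }
  change (Rabs (Cmod (u n - l) - 0) < eps).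
  rewrite Rminus_0_r, Rabs_pos_eq; auto using Cmod_ge_0.
Qed.

Lemma filterlim_double_S : filterlim (fun n => S (2 * n)) eventually eventually.
Proof. intros P [N HN]. exists N. intros n Hn. apply HN. lia. Qed.

Lemma tGamma_partial_limit (x : C) : 0 < Re x ->
  C_lim_seq (tGamma_partial x)
    (Cexp (- (x * RtoC (ln 2))) * (barGamma1 x * barGamma1 1) * x)%C.
Proof.
  intros Hx.
  set (l := (Cexp (- (x * RtoC (ln 2))) * (barGamma1 x * barGamma1 1) * x)%C).
  assert (Even : C_lim_seq (fun M => tGamma_partial x (2 * M)) l).
  { assert (L1 : C_lim_seq (fun M => Cexp (- x * RtoC (alt_harmonic (2 * M) 1)))%C
              (Cexp (- x * RtoC (ln 2)))).
    { apply C_lim_seq_Cexp, C_lim_seq_scal.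
      apply (C_lim_seq_subseq (fun n => RtoC (alt_harmonic n 1))); [apply filterlim_double|].
      apply C_lim_seq_RtoC, alt_harmonic_limit. }
    assert (L2 := C_lim_seq_mult _ _ _ _ (barGamma1_limit x Hx) (barGamma1_limit 1 Re_1_pos)).
    assert (L3 : C_lim_seq (fun M => x / (1 + x / RtoC (INR (2 * M))))%C (x / (1 + RtoC 0))%C).
    { apply C_lim_seq_div; [rewrite Cplus_0_r; apply C1_nz | apply C_lim_seq_const|].
      apply C_lim_seq_plus; [apply C_lim_seq_const|].
      apply (C_lim_seq_subseq (fun n => x / RtoC (INR n))%C); [apply filterlim_double|].
      apply C_lim_seq_x_over. }
    replace (x / (1 + RtoC 0))%C with x in L3 by (field; rewrite Cplus_0_r; apply C1_nz).
    assert (L4 := C_lim_seq_mult _ _ _ _ (C_lim_seq_mult _ _ _ _ L1 L2) L3).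
    unfold l. replace (- (x * RtoC (ln 2)))%C with (- x * RtoC (ln 2))%C by ring.
    revert L4. apply C_lim_seq_ext_loc. exists 1%nat. intros M HM.
    assert (PM : 0 < INR M) by (apply lt_0_INR; lia).
    rewrite tGamma_partial_even by assumption.
    replace (- x * RtoC (alt_harmonic (2 * M) 1))%C
      with (- (x * RtoC (alt_harmonic (2 * M) 1)))%C by ring.
    rewrite mult_INR. change (INR 2) with 2.
    assert (Q : 0 < 2 * INR M) by lra.
    assert (S0 : 0 < sqrt (2 * INR M)) by now apply sqrt_lt_R0.
    assert (SS : (RtoC (sqrt (2 * INR M)) * RtoC (sqrt (2 * INR M)))%C = RtoC (2 * INR M))
      by (rewrite <- RtoC_mult, sqrt_sqrt; auto; lra).
    rewrite RtoC_inv by lra. rewrite <- SS.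
    set (w := RtoC (sqrt (2 * INR M))) in *.
    assert (W0 : w <> RtoC 0) by (intros E; apply RtoC_inj in E; lra).
    assert (W1 : (w * w + x)%C <> RtoC 0)
      by (rewrite SS; apply Re_pos_neq_0, Re_shift_pos; auto; lra).
    field. repeat split; auto. }
  apply C_lim_seq_even_odd; [exact Even|].
  apply C_lim_seq_ext with (fun M => tGamma_partial x (2 * M) * tGamma_factor x (S (2 * M)))%C;
    [reflexivity|].
  replace l with (l * (Cexp (- (1) * RtoC 0) * (1 + RtoC 0)))%C.
  2:{ replace (- (1) * RtoC 0)%C with (RtoC 0) by ring. rewrite Cexp_0. ring. }
  apply C_lim_seq_mult; [exact Even|].
  assert (L := C_lim_seq_subseq _ _ _ filterlim_double_S (C_lim_seq_x_over x)).
  apply C_lim_seq_ext with (fun M => Cexp (- (1) * (x / RtoC (INR (S (2 * M)))))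
      * (1 + x / RtoC (INR (S (2 * M)))))%C.
  { intros M. rewrite tGamma_factor_odd. f_equal. f_equal. ring. }
  apply C_lim_seq_mult.
  - apply C_lim_seq_Cexp, C_lim_seq_scal, L.
  - apply C_lim_seq_plus; [apply C_lim_seq_const | exact L].
Qed.

Lemma tGamma_barGamma1 (x : C) : 0 < Re x ->
  tGamma x = (RtoC (sqrt (PI / 2)) * barGamma1 x)%C.
Proof.
  intros Hx. assert (X0 := Re_pos_neq_0 x Hx).
  assert (E : Cprod_infty (fun k => tGamma_factor x (S k)) =
    (Cexp (- (x * RtoC (ln 2))) * (barGamma1 x * barGamma1 1) * x)%C).
  { unfold Cprod_infty.
    apply (iota_filterlim_locally (V := C_R_CompleteNormedModule) (F := eventually)).
    apply filterlim_C_lim_seq. now apply tGamma_partial_limit. }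
  unfold tGamma. rewrite E, Cexp_opp, barGamma1_1. field.
  split; auto. apply Cexp_neq_0.
Qed.

(** * Evaluation of the regularized products *)

Theorem corollary3p2 :
  (forall x : C, 0 < Re x ->
     (is_zreg_prod (fun n => RtoC (INR n) + x)%C
                   (fun n => (-1) ^ (n + 1)) (barGamma1 x) /\
      barGamma1 x =
        (RtoC (1 / sqrt 2) *
         (Gamma (x / RtoC 2) / Gamma ((x + RtoC 1) / RtoC 2)))%C) /\
     is_zreg_prod (fun n => RtoC (INR n) + x)%C
                  (fun n => (-1) ^ n) (RtoC (sqrt (PI / 2)) / tGamma x)%C) /\
  (* the product over n >= 1, reindexed by n = k + 1 *)
  (is_zreg_prod (fun k => RtoC (INR (k + 1)))
                (fun k => (-1) ^ (k + 1)) (barGamma1 (RtoC 1)) /\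
   barGamma1 (RtoC 1) = RtoC (sqrt (PI / 2))).
Proof.
  split; [|split].
  - intros x Hx. split; [split|].
    + now apply zreg_prod_barGamma1.
    + now apply barGamma1_Gamma.
    + rewrite tGamma_barGamma1 by assumption.
      replace (RtoC (sqrt (PI / 2)) / (RtoC (sqrt (PI / 2)) * barGamma1 x))%C
        with (/ barGamma1 x)%C.
      * now apply zreg_prod_inv_barGamma1.
      * field. split.
        -- rewrite barGamma1_eta_log by assumption. apply Cexp_neq_0.
        -- intros E. apply RtoC_inj in E. assert (P := PI_RGT_0).
           assert (0 < sqrt (PI / 2)) by (apply sqrt_lt_R0; lra). lra.
  - replace (fun k => RtoC (INR (k + 1))) with (fun n => RtoC (INR n) + RtoC 1)%C.
    + apply zreg_prod_barGamma1, Re_1_pos.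
    + apply functional_extensionality. intros k.
      now rewrite plus_INR, RtoC_plus.
  - exact barGamma1_1.
Qed.
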